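(* Let $P$ and $Q$ be Borel probability measures on $\mathbb{R}^d$ supported on bounded sets $\Omega\subset\mathbb{R}^d$ and $\Omega'\subset\mathbb{R}^d$, respectively, with Minkowski dimensions $\dim_M(\Omega)$ and $\dim_M(\Omega')$, and let the cost $c:\mathbb{R}^d\times\mathbb{R}^d\to\mathbb{R}$ be Lipschitz. Let $p\in[1,\infty)$. Then for every real $\alpha>\min(\dim_M(\Omega),\dim_M(\Omega'))$ there exist constants $C>0$ and $\varepsilon_0>0$ (independent of $n$ and $\varepsilon$) such that for all $n\in\mathbb{N}$, $n\ge1$, and all $\varepsilon\in(0,\varepsilon_0]$, $$\bigl|\mathbb{E}\bigl[\widehat{\mathrm{OT}}_{\phi_p,\varepsilon}\bigr]-\mathrm{OT}_{\phi_p,\varepsilon}\bigr|\le C\,\frac{\varepsilon^{-\frac{\alpha}{2(1+(p-1)\alpha)}}}{\sqrt{n}}.$$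
   Context: Regularizers: $\phi_p(t)=\frac1p t^p$ for $p\in(1,\infty)$ and $\phi_1(t)=t\log t$ (with $0\log 0=0$), $t\ge0$. For probability measures $\mu,\nu$ on $\mathbb{R}^d$ and $\varepsilon>0$, $\Pi(\mu,\nu)$ is the set of couplings of $\mu$ and $\nu$ and $$\mathrm{OT}_{\phi,\varepsilon}(\mu,\nu)=\inf_{\pi\in\Pi(\mu,\nu)}\int c\,d\pi+\varepsilon D_\phi(\pi|\mu\otimes\nu),\qquad D_\phi(\pi|\mu\otimes\nu)=\int\phi\Bigl(\frac{d\pi}{d(\mu\otimes\nu)}\Bigr)d(\mu\otimes\nu),$$ with $D_\phi(\pi|\mu\otimes\nu)=\infty$ if $\pi\not\ll\mu\otimes\nu$. Sampling: $X_1,\dots,X_n,Y_1,\dots,Y_n$ are independent with $X_i\sim P$, $Y_j\sim Q$; $\widehat P=\frac1n\sum_{i}\delta_{X_i}$, $\widehat Q=\frac1n\sum_j\delta_{Y_j}$. Write $\mathrm{OT}_{\phi,\varepsilon}=\mathrm{OT}_{\phi,\varepsilon}(P,Q)$ and $\widehat{\mathrm{OT}}_{\phi,\varepsilon}=\mathrm{OT}_{\phi,\varepsilon}(\widehat P,\widehat Q)$. (Upper) Minkowski dimension of a bounded set $\Omega$: $\dim_M(\Omega)=\limsup_{\delta\to0}\frac{\log\mathcal{N}(\Omega,\delta)}{-\log\delta}$, where $\mathcal{N}(\Omega,\delta)$ is the smallest $N$ such that there exist $x_1,\dots,x_N\in\Omega$ with $\Omega\subset\bigcup_{i=1}^N\mathbb{B}_\delta(x_i)$,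 $\mathbb{B}_\delta(x)$ being the open Euclidean ball. *)

(* Defs.v *)
From HB Require Import structures.
From mathcomp Require Import all_boot all_order all_algebra.
From mathcomp Require Import all_classical all_reals all_analysis.

Set Implicit Arguments.
Unset Strict Implicit.
Unset Printing Implicit Defensive.

Import Order.TTheory GRing.Theory Num.Theory.
Import numFieldNormedType.Exports.

Local Open Scope classical_set_scope.
Local Open Scope ring_scope.
Local Open Scope charge_scope.

(* R^d is 'rV[R]_d, with the Borel sigma-algebra of its topology. *)
HB.instance Definition _ (R : realType) (d : nat) :=
  @isMeasurable.Build (sigma_display (@open 'rV[R]_d)) 'rV[R]_d
    <<s @open 'rV[R]_d >> (@sigma_algebra0 _ setT _) (@sigma_algebraC _ _)
    (@sigma_algebra_bigcup _ setT _).

Section euclidean_space.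
Variables (R : realType) (d : nat).
Local Notation E := 'rV[R]_d.

(* The library norm on 'rV[R]_d is the sup norm. *)
Definition enorm (x : E) : R := Num.sqrt (\sum_(i < d) x ord0 i ^+ 2).

Definition eball (x : E) (r : R) : set E := [set y | enorm (y - x) < r].

Definition lipschitz_cost (c : E * E -> R) := exists L : R, forall z z' : E * E,
  `|c z - c z'| <=
    L * Num.sqrt (enorm (z.1 - z'.1) ^+ 2 + enorm (z.2 - z'.2) ^+ 2).

Definition is_covering (Om : set E) (r : R) (N : nat) :=
  exists2 x : 'I_N -> E, (forall i, Om (x i)) &
    Om `<=` \bigcup_(i in [set: 'I_N]) eball (x i) r.

(* For a bounded set and r > 0 the infimum is a minimum over a nonempty set of
   natural numbers; it is +oo when no finite covering exists. *)
Definition covering_number (Om : set E) (r : R) : \bar R :=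
  ereal_inf [set N%:R%:E | N in is_covering Om r].

Definition minkowski_dim (Om : set E) : \bar R :=
  limf_esup (fun r : R => (lne (covering_number Om r) * ((- ln r)^-1)%:E)%E)
    0^'+.

End euclidean_space.

(* ln 0 = 0 in the library, so the value at t = 0 is 0 also for p = 1. *)
Definition phi_p (R : realType) (p t : R) : R :=
  if p == 1 then t * ln t else p^-1 * t `^ p.

Definition divergence d (T : measurableType d) (R : realType) (phi : R -> R)
    (pi rho : probability T R) : \bar R :=
  if `[< pi `<< rho >] then
    (\int[rho]_z
      (phi (fine ('d (charge_of_finite_measure pi) '/d rho z)))%:E)%E
  else +oo%E.

Section optimal_transport.
Context d1 d2 (T1 : measurableType d1) (T2 : measurableType d2) (R : realType).
Local Open Scope ereal_scope.

Definition coupling (mu : probability T1 R) (nu : probability T2 R) :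
    set (probability (T1 * T2)%type R) :=
  [set pi | (forall A, measurable A -> pi (A `*` setT) = mu A) /\
            (forall B, measurable B -> pi (setT `*` B) = nu B)].

Definition OT (phi : R -> R) (eps : R) (c : T1 * T2 -> R)
    (mu : probability T1 R) (nu : probability T2 R) : \bar R :=
  ereal_inf [set \int[pi]_z (c z)%:E + eps%:E * divergence phi pi (mu \x nu)
            | pi in coupling mu nu].

End optimal_transport.

Section empirical_measure.
Context d (T : measurableType d) (R : realType) (n : nat).
Local Open Scope ereal_scope.

Definition empirical (x : 'I_n.+1 -> T) (A : set T) : \bar R :=
  (n.+1%:R^-1)%:E * \sum_(i < n.+1) \d_(x i) A.

Variable x : 'I_n.+1 -> T.

Let empiricalE : empirical x =
  mscale (n.+1%:R^-1)%:nng%R (msum (fun i => \d_(x (inord i))) n.+1).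
Proof.
apply/funext => A; rewrite /empirical /mscale /msum /=; congr (_ * _).
by apply: eq_bigr => i _; rewrite inord_val.
Qed.

Let empirical0 : empirical x set0 = 0.
Proof. by rewrite empiricalE measure0. Qed.

Let empirical_ge0 A : 0 <= empirical x A.
Proof. by rewrite empiricalE. Qed.

Let empirical_sigma_additive : semi_sigma_additive (empirical x).
Proof. by rewrite empiricalE; exact: measure_semi_sigma_additive. Qed.

HB.instance Definition _ := isMeasure.Build _ _ _ (empirical x)
  empirical0 empirical_ge0 empirical_sigma_additive.

Let empirical_setT : empirical x setT = 1.
Proof.
rewrite /empirical (eq_bigr (fun=> 1)); last by move=> i _; rewrite diracT.
by rewrite sumEFin -EFinM sumr_const card_ord mulVf ?pnatr_eq0.
Qed.

HB.instance Definition _ :=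
  Measure_isProbability.Build _ _ _ (empirical x) empirical_setT.

End empirical_measure.
Arguments empirical {d T R n} x A.

Section sampling.
Context dS (S : measurableType dS) dT (T : measurableType dT) (R : realType).
Variable Pr : probability S R.

Definition mutually_independent (I : finType) (Z : I -> {RV Pr >-> T}) :=
  forall (J : {set I}) (A : I -> set T), (forall i, measurable (A i)) ->
    Pr (\bigcap_(i in [set` J]) (Z i @^-1` A i)) =
    (\prod_(i in J) Pr (Z i @^-1` A i))%E.

Definition has_law (X : {RV Pr >-> T}) (P : probability T R) :=
  forall A, measurable A -> distribution Pr X A = P A.

Definition pooled (n : nat) (X Y : 'I_n -> {RV Pr >-> T}) (k : 'I_n + 'I_n) :
    {RV Pr >-> T} :=
  match k with inl i => X i | inr j => Y j end.

Definition two_sample (n : nat) (P Q : probability T R)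
    (X Y : 'I_n -> {RV Pr >-> T}) :=
  [/\ forall i, has_law (X i) P, forall j, has_law (Y j) Q
    & mutually_independent (pooled X Y)].

End sampling.

(* Main.v *)
(* The proof goes through finite problems. For a cost that is constant on the
   products of the cells of two finite measurable partitions, OT depends only
   on the cell masses a, b and is the maximum of the concave dual functional
     sum a f + sum b g - eps sum a b psi((f + g - c) / eps),  psi := phi_p^*,
   attained by bounded potentials; at an optimum z := psi'((f + g - c) / eps)
   is the density of the optimal coupling. The given Lipschitz cost is within
   eta of such a cost, for eta as small as we please.

   Let (f, g) be optimal for (P, Q). Evaluated at (f, g), the empirical dual
   functional has expectation exactly OT(P, Q), since the X_i are independent
   of the Y_j; hence the bias is nonnegative. By concavity the empirical
   optimum exceeds this value by at most a constant times the L^1 norm of the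
   defects 1 - \int z d\hat Q and 1 - \int z d\hat P, which are centered, so
   that their expected size is at most ||z||_{L^2(P x Q)} / sqrt n.

   To bound ||z||, note that f inherits the modulus of continuity of c. Hence
   if z(x, y) >= m then z(x', y) >= z(x, y) / kappa for all x' in the ball of
   radius delta ~ eps m^(p-1) around x. As z(., y) has mass 1, this gives
   z(x, y) <= m + kappa / P(ball), and ||z||^2 <= m + kappa N(Omega, delta).
   Taking m = eps^(- alpha / (1 + (p - 1) alpha)) makes delta ~ m^(-1/alpha),
   so that N(Omega, delta) = O(m). *)

Require Import Defs.
From HB Require Import structures.
From mathcomp Require Import all_boot all_order all_algebra.
From mathcomp Require Import all_classical all_reals all_analysis.
From mathcomp Require Import measurable_realfun measurable_fun_approximation.
From mathcomp Require Import ring lra.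
Import Order.TTheory GRing.Theory Num.Theory.
Import numFieldNormedType.Exports.

Set Implicit Arguments.
Unset Strict Implicit.
Unset Printing Implicit Defensive.

Local Open Scope classical_set_scope.
Local Open Scope ring_scope.

(** * The convex conjugate of the regularizer *)

Section conjugate.
Context (R : realType).
Implicit Types p s t : R.

Lemma powRVK s t : t != 0 -> 0 <= s -> s = (s `^ t^-1) `^ t.
Proof. by move=> t0 s0; rewrite -powRrM mulVf// powRr1. Qed.

(** The inverse of the derivative of [phi_p p], which is ln t + 1 for p = 1 and t^(p-1) for p > 1.
    In the second case slopes s <= 0 give 0. *)
Definition dpsi p s : R :=
  if p == 1 then expR (s - 1) else Num.max s 0 `^ (p - 1)^-1.

(* The conjugate of [phi_p p] on [0, +oo[, in the form given by equality in
   the Fenchel-Young inequality; [dpsi p] is its derivative. *)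
Definition psi p s : R := s * dpsi p s - phi_p p (dpsi p s).

Lemma dpsi_ge0 p s : 0 <= dpsi p s.
Proof. by rewrite /dpsi; case: ifP => _; rewrite ?expR_ge0 ?powR_ge0. Qed.

Lemma dpsi1 p : dpsi p 1 = 1.
Proof.
by rewrite /dpsi subrr expR0 max_l ?ler01// powR1; case: ifP.
Qed.

(** For p = 1 this is 1 + x <= exp x at x = s - 1 - ln t, multiplied by t. For p > 1 it is Young's
    inequality for t and the positive part u of s, the exponent conjugate to p being 1 + r with r =
    1/(p-1). *)
Lemma fenchel_young p s t : 1 <= p -> 0 <= t -> s * t - psi p s <= phi_p p t.
Proof.
move=> p1 t0; rewrite /psi /phi_p /dpsi; case: ifPn => [_|pn1].
  rewrite expRK; have [->|tn0] := eqVneq t 0.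
    by rewrite mul0r mulr0; have := expR_gt0 (s - 1); lra.
  have tp : 0 < t by rewrite lt_neqAle eq_sym tn0.
  have := expR_ge1Dx (s - 1 - ln t); rewrite expRB lnK ?posrE//.
  rewrite ler_pdivlMr// => h.
  set e := expR _ in h *; nra.
have p1' : 1 < p by rewrite lt_neqAle eq_sym pn1.
have p0 : 0 < p by lra.
have pB : p - 1 != 0 by rewrite subr_eq0.
have [r [r0 rp ->]] : exists r, [/\ 0 < r, r * p = 1 + r & (p - 1)^-1 = r].
  exists (p - 1)^-1; split => //; first by rewrite invr_gt0; lra.
  by rewrite -{2}(subrK 1 p) mulrDr mulr1 mulVf.
set u := Num.max s 0.
have [u0 su e2] : [/\ 0 <= u, s <= u & s * u `^ r = u * u `^ r].
  rewrite le_max lexx orbT le_max lexx; split => //.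
  rewrite /u; case: (leP s 0) => // s0.
  by rewrite powR0 ?gt_eqF// !mulr0.
have e3 : u `^ (1 + r) = u * u `^ r.
  rewrite powRD ?powRr1//; apply/implyP; rewrite gt_eqF //; lra.
have e1 : (u `^ r) `^ p = u * u `^ r by rewrite -powRrM rp.
have q0 : 0 < 1 + r by lra.
have q1 : (1 + r)^-1 = 1 - p^-1.
  apply: (mulfI (lt0r_neq0 q0)); rewrite mulfV ?gt_eqF//.
  by rewrite mulrBr mulr1 -{2}rp mulfK ?gt_eqF// addrK.
have := @conjugate_powR R u t (1 + r) p u0 t0 q0 p0.
rewrite q1 subrK e3 => /(_ erefl) Y.
have st : s * t <= u * t by rewrite ler_wpM2r.
rewrite e1 e2.
rewrite -(mulrC (t `^ p)); set w := u * u `^ r in Y *; nra.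
Qed.

(** Fenchel-Young at [s'] and [t = dpsi p s], a point where equality holds for [s] by the definition
    of [psi]. *)
Lemma psi_subgradient p s s' : 1 <= p ->
  psi p s + dpsi p s * (s' - s) <= psi p s'.
Proof.
move=> p1; have := fenchel_young s' p1 (dpsi_ge0 p s).
by rewrite {2}/psi; lra.
Qed.

Lemma phi_p_dpsi p s : phi_p p (dpsi p s) = s * dpsi p s - psi p s.
Proof. rewrite /psi; lra. Qed.

Lemma dpsi_mono p s s' : 1 <= p -> s <= s' -> dpsi p s <= dpsi p s'.
Proof.
move=> p1 ss'; rewrite /dpsi; case: ifP => [_|pn1].
  by rewrite ler_expR lerB.
apply: ge0_ler_powR; rewrite ?nnegrE ?invr_ge0 ?subr_ge0//.
- by rewrite le_max lexx orbT.
- by rewrite le_max lexx orbT.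
- by rewrite ge_max !le_max ss' lexx orbT.
Qed.

(** For p > 1 the function vanishes on the half-line s <= 0 and is not strictly increasing there,
    hence the positivity hypothesis. *)
Lemma dpsi_smono p s s' : 1 <= p -> s < s' -> 0 < dpsi p s ->
  dpsi p s < dpsi p s'.
Proof.
move=> p1 ss'; rewrite /dpsi; case: ifPn => [_|pn1].
  by rewrite ltr_expR ltrD2r.
have r0 : 0 < (p - 1)^-1.
  by rewrite invr_gt0 subr_gt0 lt_neqAle eq_sym pn1.
have u0 : 0 <= Num.max s 0 by rewrite le_max lexx orbT.
move=> /(gt0_powR r0 u0); rewrite lt_max ltxx orbF => s0.
apply: gt0_ltr_powR; rewrite ?nnegrE//.
  by rewrite le_max lexx orbT.
by rewrite !max_l // ltW// (lt_trans s0).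
Qed.

Lemma dpsi_lt1 p s : 1 <= p -> s < 1 -> dpsi p s < 1.
Proof.
move=> p1 s1; have := dpsi_ge0 p s; rewrite le_eqVlt => /predU1P[<-//|].
by move=> /(dpsi_smono p1 s1); rewrite dpsi1.
Qed.

Lemma dpsi_gt1 p s : 1 <= p -> 1 < s -> 1 < dpsi p s.
Proof. by move=> p1 s1; rewrite -(dpsi1 p) dpsi_smono// dpsi1. Qed.

(** The factor by which [dpsi p] may drop, from a value of at least M, when its argument decreases
    by M^(p-1) / 2. It does not depend on M. *)
Definition kappa p : R := if p == 1 then expR 2^-1 else 2 `^ (p - 1)^-1.

Lemma kappa_gt0 p : 0 < kappa p.
Proof. by rewrite /kappa; case: ifP => _; rewrite ?expR_gt0 ?powR_gt0. Qed.

(** For p = 1 a decrease of s by 1/2 costs a factor exp(1/2). For p > 1 the bound [M <= dpsi p s]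
    says that s >= M^(p-1), so that s' >= s/2, and [dpsi p] is the power of exponent 1/(p-1) on
    positive arguments. *)
Lemma dpsi_compare p M s s' : 1 <= p -> 1 <= M -> M <= dpsi p s ->
  s - M `^ (p - 1) / 2 <= s' -> dpsi p s <= kappa p * dpsi p s'.
Proof.
move=> p1 M1; rewrite /dpsi /kappa; case: ifPn => [/eqP ->|pn1].
  rewrite subrr powRr0 -expRD => _ h; rewrite ler_expR; lra.
have pB : 0 < p - 1 by rewrite subr_gt0 lt_neqAle eq_sym pn1.
have r0 : 0 < (p - 1)^-1 by rewrite invr_gt0.
have u0 : 0 <= Num.max s 0 by rewrite le_max lexx orbT.
move=> Ms.
have us : M `^ (p - 1) <= Num.max s 0.
  rewrite (powRVK (lt0r_neq0 pB) u0).
  by apply: ge0_ler_powR; rewrite ?nnegrE ?powR_ge0 ?(ltW pB)//; lra.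
have Mp : 0 < M `^ (p - 1) by rewrite powR_gt0; lra.
have s0 : 0 < s.
  have : 0 < Num.max s 0 by apply: lt_le_trans us.
  by rewrite lt_max ltxx orbF.
move=> h; rewrite max_l in us *; last exact: ltW.
have s'0 : 0 <= s' by lra.
rewrite max_l// -powRM//.
by apply: ge0_ler_powR; rewrite ?nnegrE ?mulr_ge0 ?(ltW r0) ?(ltW s0)//; lra.
Qed.

Lemma dpsi_continuous p : 1 <= p -> continuous (dpsi p).
Proof.
move=> p1 s; rewrite /dpsi; have [_|pn1] := eqVneq p 1.
  apply: continuous_comp; last exact: continuous_expR.
  by apply: cvgB; [exact: cvg_id|exact: cvg_cst].
have r0 : 0 < (p - 1)^-1.
  by rewrite invr_gt0 subr_gt0 lt_neqAle eq_sym pn1.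
set r := (p - 1)^-1 in r0 *.
have [s0|s0|->] := ltgtP s 0.
- rewrite /continuous_at max_r ?powR0 ?gt_eqF ?(ltW s0)//.
  apply/cvgrPdist_le => e e0; near=> y.
  rewrite max_r ?powR0 ?gt_eqF ?subrr ?normr0 ?(ltW e0)//.
  by apply: ltW; near: y; exact: lt_nbhsl.
- have cE : expR (r * ln y) @[y --> s] --> expR (r * ln s).
    apply: (cvg_comp (fun y => r * ln y) (@expR R)); last exact: continuous_expR.
    by apply: cvgM; [exact: cvg_cst|exact: continuous_ln].
  have powE y : 0 < y -> Num.max y 0 `^ r = expR (r * ln y).
    by move=> y0; rewrite max_l ?ltW// /powR gt_eqF.
  rewrite /continuous_at powE//.
  move/cvgrPdist_le : cE => cE; apply/cvgrPdist_le => e e0.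
  near=> y; rewrite powE; first by near: y; exact: cE.
  by near: y; exact: lt_nbhsr.
- rewrite /continuous_at maxxx powR0 ?gt_eqF//.
  apply/cvgrPdist_le => e e0.
  near=> y; rewrite sub0r normrN ger0_norm ?powR_ge0//.
  have ye : Num.max y 0 <= e `^ r^-1.
    rewrite ge_max powR_ge0 andbT.
    apply: ltW; near: y; apply: lt_nbhsl; exact: powR_gt0.
  rewrite (powRVK (lt0r_neq0 r0) (ltW e0)).
  by apply: ge0_ler_powR; rewrite ?nnegrE ?powR_ge0 ?le_max ?lexx ?orbT ?(ltW r0).
Unshelve. all: by end_near. Qed.

(** The subgradient inequalities at s and at y squeeze [psi p y] between two expressions that tend
    to [psi p s], by the continuity of [dpsi]. *)
Lemma psi_continuous p : 1 <= p -> continuous (psi p).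
Proof.
move=> p1 s; rewrite /continuous_at.
have ys : (y - s @[y --> s] --> (0 : R)) by apply/subr_cvg0.
have dl : psi p s + dpsi p s * (y - s) @[y --> s] --> psi p s.
  rewrite -[X in _ --> X]addr0 -[X in _ + X](mulr0 (dpsi p s)).
  by apply: cvgD; [exact: cvg_cst|apply: cvgM; [exact: cvg_cst|]].
have du : psi p s + dpsi p y * (y - s) @[y --> s] --> psi p s.
  rewrite -[X in _ --> X]addr0 -[X in _ + X](mulr0 (dpsi p s)).
  by apply: cvgD; [exact: cvg_cst|apply: cvgM; [exact: dpsi_continuous|]].
apply: (squeeze_cvgr _ dl du); near=> y; apply/andP; split.
  exact: psi_subgradient.
rewrite -lerBlDr -mulrN opprB.
exact: psi_subgradient.
Unshelve. all: by end_near. Qed.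

End conjugate.

(** * The finite dual problem *)

Lemma cvg_rsum (R : realType) (K : finType) (T : Type) (F : set_system T)
    (FF : Filter F) (h : K -> T -> R) (l : K -> R) :
  (forall k, h k x @[x --> F] --> l k) ->
  (\sum_k h k x) @[x --> F] --> \sum_k l k.
Proof.
by move=> hl; apply: cvg_big => //; exact: add_continuous.
Qed.

Lemma exists_pos_summand {R : realDomainType} (K : finType) (h : K -> R) :
  (forall k, 0 <= h k) -> 0 < \sum_k h k -> exists k, 0 < h k.
Proof.
move=> h0 s0; apply/existsP; rewrite -[X in is_true X]negbK negb_exists.
apply/negP => /forallP hn.
move: s0; rewrite big1 ?ltxx// => k _; apply/eqP; rewrite eq_le h0.
by rewrite leNgt hn.
Qed.

Section double_sum.
Context (R : realType) (I J : finType).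
Implicit Types F G : I -> J -> R.

Lemma dsumD F G : \sum_i \sum_j (F i j + G i j) =
  \sum_i \sum_j F i j + \sum_i \sum_j G i j.
Proof. by under eq_bigr do rewrite big_split/=; rewrite big_split. Qed.

Lemma dsumZ (t : R) F : \sum_i \sum_j t * F i j = t * \sum_i \sum_j F i j.
Proof. by rewrite mulr_sumr; apply: eq_bigr => i _; rewrite mulr_sumr. Qed.

Lemma ler_dsum (t : R) F G H F' :
    (forall i j, t * F i j + G i j + H i j <= t * F' i j) ->
  t * (\sum_i \sum_j F i j) + \sum_i \sum_j G i j + \sum_i \sum_j H i j
  <= t * \sum_i \sum_j F' i j.
Proof.
move=> h; rewrite -!dsumZ -!dsumD.
by apply: ler_sum => i _; apply: ler_sum => j _.
Qed.

End double_sum.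

Definition weights {R : realType} {K : finType} (a : K -> R) :=
  (forall k, 0 <= a k) /\ \sum_k a k = 1.

(** The linear arithmetic of [dual_concave], with the sums abstracted to variables. *)
Lemma dual_rearrange {R : realType} (a1 a2 b1 b2 e e' y z : R) : e + y + z <= e' ->
  a2 + b2 - e' <= a1 + b1 - e + (a2 - a1 - y) + (b2 - b1 - z).
Proof. lra. Qed.

(** Some weight is positive, so a strict inequality survives averaging. *)
Lemma weights_avg_lt1 (R : realType) (K : finType) (a r : K -> R) : weights a ->
  (forall k, r k < 1) -> \sum_k a k * r k < 1.
Proof.
move=> [a0 a1] r1.
have [k ak] : exists k, 0 < a k.
  by apply: exists_pos_summand => //; rewrite a1 ltr01.
rewrite -a1 (bigD1 k)//= [ltRHS](bigD1 k)//=; apply: ltr_leD.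
  by rewrite gtr_pMr.
by apply: ler_sum => i _; rewrite ler_piMr// ltW.
Qed.

Lemma weights_avg_gt1 (R : realType) (K : finType) (a r : K -> R) : weights a ->
  (forall k, 1 < r k) -> 1 < \sum_k a k * r k.
Proof.
move=> [a0 a1] r1.
have [k ak] : exists k, 0 < a k.
  by apply: exists_pos_summand => //; rewrite a1 ltr01.
rewrite -a1 (bigD1 k)//= [ltRHS](bigD1 k)//=; apply: ltr_leD.
  by rewrite ltr_pMr.
by apply: ler_sum => i _; rewrite ler_peMr// ltW.
Qed.

(** Feasible directions of a segment: any s at an interior point, an inward one at an endpoint. *)
Lemma near_segment_add (R : realType) (x lo hi s : R) : lo <= x <= hi ->
  (0 < s -> x < hi) -> (s < 0 -> lo < x) ->
  \forall t \near 0^'+, lo <= x + t * s <= hi.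
Proof.
move=> /andP[lox xhi] hs ls; have [s0|s0|->] := ltgtP s 0.
- near=> t; have t0 : 0 < t by near: t; exact: nbhs_right_gt.
  have ts : t * - s <= x - lo.
    rewrite -ler_pdivlMr ?oppr_gt0//; near: t; apply: nbhs_right_le.
    by rewrite divr_gt0 ?oppr_gt0// subr_gt0; exact: ls.
  have : t * s <= 0 by rewrite pmulr_rle0// ltW.
  by move=> ts0; apply/andP; split; lra.
- near=> t; have t0 : 0 < t by near: t; exact: nbhs_right_gt.
  have ts : t * s <= hi - x.
    rewrite -ler_pdivlMr//; near: t; apply: nbhs_right_le.
    by rewrite divr_gt0// subr_gt0; exact: hs.
  have : 0 <= t * s by rewrite mulr_ge0// ltW.
  by move=> ts0; apply/andP; split; lra.
- by near=> t; rewrite mulr0 addr0 lox.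
Unshelve. all: by end_near. Qed.

Lemma sum_delta (R : realType) (K : finType) (a r : K -> R) (s : R) (i : K) :
  \sum_k a k * ((s * (k == i)%:R) * r k) = s * (a i * r i).
Proof.
rewrite (bigD1 i)//= eqxx mulr1 big1 ?addr0; first by rewrite mulrCA.
by move=> k /negPf ->; rewrite mulr0 mul0r mulr0.
Qed.

Section dual_problem.
Context (R : realType) (I J : finType) (p eps : R) (C : I -> J -> R).
Hypotheses (p1 : 1 <= p) (eps0 : 0 < eps).
Implicit Types (a f u : I -> R) (b g v : J -> R).

Definition slack f g i j : R := (f i + g j - C i j) / eps.

Definition density f g i j : R := dpsi p (slack f g i j).

Definition dual a b f g : R :=
  \sum_i a i * f i + \sum_j b j * g j
  - eps * \sum_i \sum_j a i * b j * psi p (slack f g i j).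

(** [a i * rowdef b f g i] is the partial derivative of [dual] in [f i]. The defect vanishes when
    the density satisfies the marginal constraint of row i; likewise for columns. *)
Definition rowdef b f g i : R := 1 - \sum_j b j * density f g i j.
Definition coldef a f g j : R := 1 - \sum_i a i * density f g i j.

(** The supergradient inequality at an arbitrary base point: [psi_subgradient] at each pair of
    cells, weighted by [a i * b j] and summed. The factor [eps] cancels the division in [slack]. *)
Lemma dual_concave a b f g f' g' : (forall i, 0 <= a i) -> (forall j, 0 <= b j) ->
  dual a b f' g' <= dual a b f g
    + \sum_i a i * ((f' i - f i) * rowdef b f g i)
    + \sum_j b j * ((g' j - g j) * coldef a f g j).
Proof.
move=> a0 b0.
pose X i j := a i * b j * psi p (slack f g i j).
pose X' i j := a i * b j * psi p (slack f' g' i j).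
pose Y i j := a i * b j * (density f g i j * (f' i - f i)).
pose Z i j := a i * b j * (density f g i j * (g' j - g j)).
have key : eps * (\sum_i \sum_j X i j) + (\sum_i \sum_j Y i j)
    + (\sum_i \sum_j Z i j) <= eps * \sum_i \sum_j X' i j.
  apply: ler_dsum => i j; rewrite /X /Y /Z /X'.
  have := psi_subgradient (slack f g i j) (slack f' g' i j) p1.
  rewrite -/(density f g i j) => h.
  have : eps * (psi p (slack f g i j) + density f g i j *
     (slack f' g' i j - slack f g i j)) <= eps * psi p (slack f' g' i j).
    by rewrite ler_pM2l.
  rewrite mulrDr.
  have -> : eps * (density f g i j * (slack f' g' i j - slack f g i j)) =
     density f g i j * ((f' i - f i) + (g' j - g j)).
    by rewrite /slack; field; rewrite gt_eqF.
  move=> /(ler_wpM2l (mulr_ge0 (a0 i) (b0 j))); rewrite [leRHS]mulrCA.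
  by apply: le_trans; rewrite le_eqVlt; apply/orP; left; apply/eqP; ring.
rewrite /dual;
have -> : \sum_i a i * ((f' i - f i) * rowdef b f g i) =
   \sum_i a i * f' i - \sum_i a i * f i
   - \sum_i \sum_j Y i j.
  rewrite -2!sumrB; apply: eq_bigr => i _; rewrite /rowdef.
  rewrite mulrBr mulr1 mulrBr mulrBr; congr (_ - _).
  rewrite mulrA mulr_sumr; apply: eq_bigr => j _; rewrite /Y; ring.
have -> : \sum_j b j * ((g' j - g j) * coldef a f g j) =
   \sum_j b j * g' j - \sum_j b j * g j
   - \sum_i \sum_j Z i j.
  rewrite [X in _ = _ - X]exchange_big -2!sumrB; apply: eq_bigr => j _.
  rewrite /coldef.
  rewrite mulrBr mulr1 mulrBr mulrBr; congr (_ - _).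
  rewrite mulrA mulr_sumr; apply: eq_bigr => i _; rewrite /Z; ring.
exact: dual_rearrange key.
Qed.

(** Stationarity is asked only where the mass is positive: elsewhere the dual does not see the
    potential, and empirical weights vanish on the cells that no sample point visits. *)
Definition optimal a b f g :=
  (forall i, 0 < a i -> rowdef b f g i = 0) /\
  (forall j, 0 < b j -> coldef a f g j = 0).

Lemma dual_le_optimal a b f g f' g' : weights a -> weights b ->
  optimal a b f g -> dual a b f' g' <= dual a b f g.
Proof.
move=> [a0 _] [b0 _] [fo go].
apply: le_trans (dual_concave f g f' g' a0 b0) _.
rewrite big1 ?big1 ?addr0// => k _.
  have := b0 k; rewrite le_eqVlt => /predU1P[<-|k0]; first by rewrite mul0r.
  by rewrite go// !mulr0.
have := a0 k; rewrite le_eqVlt => /predU1P[<-|k0]; first by rewrite mul0r.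
by rewrite fo// !mulr0.
Qed.

(* Strictly larger slacks force a strictly larger row sum: this bounds the
   oscillation of an optimal potential by that of the cost. *)
Lemma row_shift b f g i i' : (forall j, 0 <= b j) ->
  (forall j, f i - C i j < f i' - C i' j) -> rowdef b f g i <= 0 ->
  rowdef b f g i' < 0.
Proof.
move=> b0 lt; rewrite /rowdef !subr_le0 subr_lt0 => r1.
have dd j : density f g i j <= density f g i' j.
  by apply: dpsi_mono => //; rewrite ler_pM2r ?invr_gt0//; have := lt j; lra.
have [j bz] : exists j, 0 < b j * density f g i j.
  apply: exists_pos_summand => [j|]; first by rewrite mulr_ge0// dpsi_ge0.
  exact: lt_le_trans r1.
apply: le_lt_trans r1 _; rewrite (bigD1 j)//= [ltRHS](bigD1 j)//=.
have bj : 0 < b j.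
  rewrite lt_neqAle b0 andbT; apply/negP => /eqP b00.
  by move: bz; rewrite -b00 mul0r ltxx.
apply: ltr_leD; last by apply: ler_sum => k _; rewrite ler_wpM2l.
rewrite ltr_pM2l//; apply: dpsi_smono => //.
  by rewrite ltr_pM2r ?invr_gt0//; have := lt j; lra.
by move: bz; rewrite pmulr_rgt0.
Qed.

(** With a larger increment of [f], all slacks of row [i'] would exceed those of row [i], and by
    [row_shift] row [i'] would sum to more than 1. *)
Lemma optimal_lipschitz a b f g i i' : weights b -> optimal a b f g ->
  0 < a i -> 0 < a i' -> forall t, (forall j, C i' j - C i j < t) ->
  f i' - f i <= t.
Proof.
move=> [b0 _] [fo _] ai ai' t Ct; rewrite leNgt; apply/negP => tf.
have : rowdef b f g i' < 0.
  apply: (row_shift (i := i)) => //; last by rewrite fo.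
  by move=> j; have := Ct j; lra.
by rewrite fo// ltxx.
Qed.

Lemma cvg_density (T : Type) (F : set_system T) (FF : Filter F)
    (ft : T -> I -> R) (gt : T -> J -> R) f g i j :
  ft x i @[x --> F] --> f i -> gt x j @[x --> F] --> g j ->
  density (ft x) (gt x) i j @[x --> F] --> density f g i j.
Proof.
move=> fi gj; rewrite /density.
apply: (cvg_comp (fun x => slack (ft x) (gt x) i j) (dpsi p));
  last exact: dpsi_continuous.
apply: cvgM; last exact: cvg_cst.
by apply: cvgB; [exact: cvgD|exact: cvg_cst].
Qed.

(* Concavity at the perturbed point bounds t times its directional derivative
   by the increment of the dual, so only the continuity of [dpsi] is needed. *)
Lemma first_order a b f g u v : (forall i, 0 <= a i) -> (forall j, 0 <= b j) ->
  (\forall t \near 0^'+, dual a b (fun i => f i + t * u i)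
                                   (fun j => g j + t * v j) <= dual a b f g) ->
  \sum_i a i * (u i * rowdef b f g i) + \sum_j b j * (v j * coldef a f g j)
    <= 0.
Proof.
move=> a0 b0 fgmax.
pose ft (t : R) i := f i + t * u i; pose gt (t : R) j := g j + t * v j.
have cf i : ft t i @[t --> 0^'+] --> f i.
  apply: cvg_at_right_filter; rewrite -[X in _ --> X]addr0 -[X in _ + X](mul0r (u i)).
  by apply: cvgD; [exact: cvg_cst|apply: cvgM; [exact: cvg_id|exact: cvg_cst]].
have cg j : gt t j @[t --> 0^'+] --> g j.
  apply: cvg_at_right_filter; rewrite -[X in _ --> X]addr0 -[X in _ + X](mul0r (v j)).
  by apply: cvgD; [exact: cvg_cst|apply: cvgM; [exact: cvg_id|exact: cvg_cst]].
pose G (t : R) := \sum_i a i * (u i * rowdef b (ft t) (gt t) i)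
   + \sum_j b j * (v j * coldef a (ft t) (gt t) j).
have cG : G t @[t --> 0^'+] -->
   \sum_i a i * (u i * rowdef b f g i) + \sum_j b j * (v j * coldef a f g j).
  apply: cvgD; apply: cvg_rsum => k.
    apply: cvgM; first exact: cvg_cst.
    apply: cvgM; first exact: cvg_cst.
    apply: cvgB; first exact: cvg_cst.
    apply: cvg_rsum => j; apply: cvgM; first exact: cvg_cst.
    exact: cvg_density.
  apply: cvgM; first exact: cvg_cst.
  apply: cvgM; first exact: cvg_cst.
  apply: cvgB; first exact: cvg_cst.
  apply: cvg_rsum => i; apply: cvgM; first exact: cvg_cst.
  exact: cvg_density.
apply: (cvgr_to_le cG); near=> t.
have t0 : 0 < t by near: t; exact: nbhs_right_gt.
have tmax : dual a b (ft t) (gt t) <= dual a b f g by near: t.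
have := dual_concave (ft t) (gt t) f g a0 b0.
move=> /le_trans/(_ (lerD (lerD tmax (lexx _)) (lexx _))).
rewrite -addrA lerDl.
have -> : \sum_i a i * ((f i - ft t i) * rowdef b (ft t) (gt t) i)
    + \sum_j b j * ((g j - gt t j) * coldef a (ft t) (gt t) j) = - (t * G t).
  rewrite /G mulrDr opprD !mulr_sumr -!sumrN; congr (_ + _).
    by apply: eq_bigr => i _; rewrite /ft opprD addrA subrr add0r !mulNr !mulrN;
       congr (- _); rewrite [RHS]mulrCA; congr (_ * _); rewrite mulrA.
  by apply: eq_bigr => j _; rewrite /gt opprD addrA subrr add0r !mulNr !mulrN;
     congr (- _); rewrite [RHS]mulrCA; congr (_ * _); rewrite mulrA.
by rewrite oppr_ge0 pmulr_rle0.
Unshelve. all: by end_near. Qed.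

Lemma cvg_dual (T : Type) (F : set_system T) (FF : Filter F)
    (ft : T -> I -> R) (gt : T -> J -> R) a b f g :
  (forall i, ft x i @[x --> F] --> f i) ->
  (forall j, gt x j @[x --> F] --> g j) ->
  dual a b (ft x) (gt x) @[x --> F] --> dual a b f g.
Proof.
move=> cf cg; rewrite /dual.
apply: cvgB.
  by apply: cvgD; apply: cvg_rsum => k; apply: cvgM => //; exact: cvg_cst.
apply: cvgM; first exact: cvg_cst.
apply: cvg_rsum => i; apply: cvg_rsum => j.
apply: cvgM; first exact: cvg_cst.
apply: (cvg_comp (fun x => slack (ft x) (gt x) i j) (psi p));
  last exact: psi_continuous.
apply: cvgM; last exact: cvg_cst.
by apply: cvgB; [exact: cvgD|exact: cvg_cst].
Qed.

(** The two potentials are joined into one function on [I + J], so that Tychonoff's theorem gives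
    the compactness of the box. *)
Lemma dual_box_max a b (B K : R) : 0 <= B -> 0 <= K ->
  exists f g, [/\ forall i, 0 <= f i <= B, forall j, - K <= g j <= K &
    forall f' g', (forall i, 0 <= f' i <= B) -> (forall j, - K <= g' j <= K) ->
      dual a b f' g' <= dual a b f g].
Proof.
move=> B0 K0.
pose box (k : I + J) : set R :=
  match k with inl _ => `[0, B]%classic | inr _ => `[- K, K]%classic end.
pose D (h : {ptws (I + J)%type -> R}) : R :=
  dual a b (fun i => h (inl i)) (fun j => h (inr j)).
have cbox : compact [set h : {ptws (I + J)%type -> R} | forall k, box k (h k)].
  by apply: tychonoff => -[i|j]; exact: segment_compact.
have cD : continuous D.
  move=> h.
  have ch k : (h' : {ptws (I + J)%type -> R}) k @[h' --> h] --> h k.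
    exact: (@proj_continuous _ (fun=> R) k h).
  apply: (@cvg_dual _ (nbhs h) _ (fun h' i => h' (inl i)) (fun h' j => h' (inr j)));
    by move=> k; exact: ch.
have nbox : [set h : {ptws (I + J)%type -> R} | forall k, box k (h k)] !=set0.
  by exists (fun=> 0) => -[i|j]; rewrite /= in_itv/= ?lexx ?B0 ?oppr_le0 ?K0.
have [h hbox hmax] := compact_EVT_max nbox cbox (continuous_subspaceT cD).
exists (fun i => h (inl i)), (fun j => h (inr j)); split => [i|j|f' g' f'B g'K].
- by move: hbox; rewrite inE => /(_ (inl i)); rewrite /= in_itv/=.
- by move: hbox; rewrite inE => /(_ (inr j)); rewrite /= in_itv/=.
apply: (hmax (fun k => match k with inl i => f' i | inr j => g' j end)).
by rewrite inE => -[i|j]; rewrite /= in_itv/=.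
Qed.

(* The maximizer over a box is a free maximizer. The bounds on [g] are too
   large to be active. Those on [f] cannot be active on both sides, as [f]
   oscillates by at most [2 * M]; so the row defects have a constant sign, and
   their weighted sum, equal to that of the column defects, is zero. *)
Lemma optimal_exists a b (M : R) : weights a -> weights b -> eps <= 1 ->
  0 <= M -> (forall i j, `|C i j| <= M) ->
  exists f g, [/\ optimal a b f g, forall i, 0 <= f i <= 4 * M + 2 &
    forall j, `|g j| <= 5 * M + 2].
Proof.
(* K = B + M makes every slack with [g j = - K] nonpositive, and K > M + eps makes it exceed 1 when
   [g j = K]; B exceeds the oscillation bound 2 M. *)
move=> wa wb eps1 M0 CM; set B := 4 * M + 2; set K := 5 * M + 2.
have B0 : 0 <= B by rewrite /B; lra.
have K0 : 0 <= K by rewrite /K; lra.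
have [f [g [fB gK fgmax]]] := dual_box_max a b B0 K0.
have [[a0 a1] [b0 b1]] := (wa, wb).
have Cle i j : C i j <= M by apply: le_trans (CM i j); exact: ler_norm.
have Cge i j : - M <= C i j by have := CM i j; rewrite ler_norml => /andP[].
have fo u v : (forall k, \forall t \near 0^'+, 0 <= f k + t * u k <= B) ->
   (forall k, \forall t \near 0^'+, - K <= g k + t * v k <= K) ->
   \sum_i a i * (u i * rowdef b f g i) + \sum_j b j * (v j * coldef a f g j)
    <= 0.
  move=> ft gt; apply: first_order => //; near=> t; apply: fgmax => k.
    by move: k; near: t; apply: filter_forall.
  by move: k; near: t; apply: filter_forall.
have const (x s lo hi : R) : lo <= x <= hi -> s = 0 ->
    \forall t \near 0^'+, lo <= x + t * s <= hi.
  by move=> xlh ->; apply: near_segment_add; rewrite ?ltxx.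
(* The first-order condition for a move of the single coordinate [f i] in direction s, which must
   point inward at an active bound. *)
have rows i s : 0 < a i -> (0 < s -> f i < B) -> (s < 0 -> 0 < f i) ->
    s * rowdef b f g i <= 0.
  move=> ai fs sf.
  have := fo (fun k => s * (k == i)%:R) (fun=> 0).
  rewrite sum_delta [X in _ + X]big1 ?addr0; last by move=> j _; rewrite mul0r mulr0.
  rewrite mulrCA pmulr_rle0//; apply=> k; last exact: const.
  have [->|ki] := eqVneq k i; last by apply: const; rewrite // mulr0.
  by rewrite mulr1; apply: near_segment_add.
have cols j s : 0 < b j -> (0 < s -> g j < K) -> (s < 0 -> - K < g j) ->
    s * coldef a f g j <= 0.
  move=> bj fs sf.
  have := fo (fun=> 0) (fun k => s * (k == j)%:R).
  rewrite sum_delta [X in X + _]big1 ?add0r; last by move=> i _; rewrite mul0r mulr0.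
  rewrite mulrCA pmulr_rle0//; apply=> k; first exact: const.
  have [->|ki] := eqVneq k j; last by apply: const; rewrite // mulr0.
  by rewrite mulr1; apply: near_segment_add.
have row_le0 i : 0 < a i -> f i < B -> rowdef b f g i <= 0.
  by move=> ai fi; rewrite -[leLHS]mul1r; apply: rows => // /ltW; rewrite ler10.
have row_ge0 i : 0 < a i -> 0 < f i -> 0 <= rowdef b f g i.
  move=> ai fi; rewrite -oppr_le0 -mulN1r; apply: rows => //.
  by rewrite ltrNr oppr0 => /ltW; rewrite ler10.
have col0 j : 0 < b j -> coldef a f g j = 0.
  move=> bj; have /andP[Kg gK'] := gK j.
  apply/eqP; rewrite eq_le; apply/andP; split.
    have [gjK|gjK] := eqVneq (g j) K; last first.
      have {}gjK : g j < K by rewrite lt_neqAle gjK.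
      by rewrite -[leLHS]mul1r; apply: cols => // /ltW; rewrite ler10.
    rewrite /coldef subr_le0; apply/ltW/weights_avg_gt1 => // i.
    apply: dpsi_gt1 => //; rewrite /slack ltr_pdivlMr// gjK /K.
    have /andP[fi _] := fB i; have := Cle i j; lra.
  have [gjK|gjK] := eqVneq (- K) (g j); last first.
    have {}gjK : - K < g j by rewrite lt_neqAle gjK.
    rewrite -oppr_le0 -mulN1r; apply: cols => //.
    by rewrite ltrNr oppr0 => /ltW; rewrite ler10.
  rewrite /coldef subr_ge0; apply/ltW/weights_avg_lt1 => // i.
  apply: dpsi_lt1 => //; rewrite /slack ltr_pdivrMr// -gjK /K.
  have /andP[_] := fB i; rewrite /B; have := Cge i j => Cij fi.
  by rewrite mul1r; apply: le_lt_trans eps0; lra.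
have osc i i' : 0 < a i -> 0 < a i' -> f i' - f i <= 2 * M.
  move=> ai ai'; rewrite leNgt; apply/negP => oscM.
  have /andP[fi _] := fB i; have /andP[_ fi'] := fB i'.
  have : rowdef b f g i' < 0.
    apply: (@row_shift b f g i i') => //; last by apply: row_le0 => //; lra.
    by move=> j; have := Cle i' j; have := Cge i j; lra.
  by rewrite ltNge row_ge0//; lra.
have sum_rows : \sum_i a i * rowdef b f g i = 0.
  transitivity (\sum_j b j * coldef a f g j).
    rewrite /rowdef /coldef.
    under eq_bigr do rewrite mulrBr mulr1 mulr_sumr.
    under [RHS]eq_bigr do rewrite mulrBr mulr1 mulr_sumr.
    rewrite !sumrB a1 b1 exchange_big/=; congr (_ - _).
    by apply: eq_bigr => i _; apply: eq_bigr => j _; rewrite mulrCA.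
  apply: big1 => j _; have := b0 j; rewrite le_eqVlt => /predU1P[<-|bj].
    by rewrite mul0r.
  by rewrite col0// mulr0.
have row0 i : 0 < a i -> rowdef b f g i = 0.
  (* If some [f k] of positive mass touches the upper bound, the oscillation bound keeps all the
     others of positive mass away from 0, and no weighted defect is negative. Otherwise none is
     positive. *)
  have [[k [ak fk]]|nk] := pselect (exists k, 0 < a k /\ B <= f k).
    have row0' l : 0 <= a l * rowdef b f g l.
      have := a0 l; rewrite le_eqVlt => /predU1P[<-|al]; first by rewrite mul0r.
      rewrite pmulr_rge0//; apply: row_ge0 => //.
      by have := osc l k al ak; rewrite /B in fk *; lra.
    move=> ai; have /(_ i isT)/eqP := @psumr_eq0P _ _ _ _ (fun l _ => row0' l) sum_rows.
    by rewrite mulf_eq0 gt_eqF//= => /eqP.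
  have row0' l : 0 <= - (a l * rowdef b f g l).
    have := a0 l; rewrite le_eqVlt => /predU1P[<-|al].
      by rewrite mul0r oppr0.
    rewrite oppr_ge0 pmulr_rle0//; apply: row_le0 => //.
    by rewrite ltNge; apply/negP => Bf; apply: nk; exists l.
  move: sum_rows => /(congr1 -%R); rewrite oppr0 -sumrN => sum_rows ai.
  have /(_ i isT)/eqP := @psumr_eq0P _ _ _ _ (fun l _ => row0' l) sum_rows.
  by rewrite oppr_eq0 mulf_eq0 gt_eqF//= => /eqP.
exists f, g; split => [|//|j]; first by split.
by rewrite ler_norml; exact: gK.
Unshelve. all: by end_near. Qed.

End dual_problem.

(** * The second moment of the optimal density *)

Lemma sum_group_ratio_le (R : realType) (I G : finType) (a : I -> R)
    (grp : I -> G) : (forall i, 0 <= a i) ->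
  \sum_i a i / (\sum_(i' | grp i' == grp i) a i') <= #|G|%:R.
Proof.
move=> a0; rewrite (partition_big grp xpredT)//= -sum1_card natr_sum.
apply: ler_sum => x _.
under eq_bigr => i /eqP -> do [].
(* Division by zero yields zero, so a group without mass contributes 0 and any other contributes
   1. *)
rewrite -mulr_suml; have [->|s0] := eqVneq (\sum_(i | grp i == x) a i) 0.
  by rewrite mul0r ler01.
by rewrite divff.
Qed.

Section second_moment.
Context (R : realType) (I J G : finType) (p eps : R) (C : I -> J -> R).
Hypotheses (p1 : 1 <= p) (eps0 : 0 < eps).
Variables (a : I -> R) (b : J -> R) (f : I -> R) (g : J -> R).
Hypotheses (wa : weights a) (wb : weights b) (fg : optimal p eps C a b f g).
Local Notation z := (density p eps C f g).

(** Groups play the role of balls. A value of z above M is comparable, up to [kappa p], to all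
    values in its column over the group; the column sum 1 then bounds it by [kappa p / P i]. This
    bound replaces one factor of z^2, the row sum 1 takes care of the other, and the sum of
    [a i / P i] is at most the number of groups. *)
Lemma second_moment_le (grp : I -> G) (M r : R) : 1 <= M ->
  (forall i i', 0 < a i -> 0 < a i' -> grp i = grp i' ->
     forall j, C i' j - C i j < r) ->
  4 * r <= eps * M `^ (p - 1) ->
  \sum_i a i * \sum_j b j * z i j ^+ 2 <= M + kappa p * #|G|%:R.
Proof.
move=> M1 Cr rM; have [a0 a1] := wa; have [b0 b1] := wb; have [rows cols] := fg.
have k0 := kappa_gt0 p.
pose P i := \sum_(i' | grp i' == grp i) a i'.
have Pge i : a i <= P i.
  by rewrite /P (bigD1 i)//= lerDl sumr_ge0.
have P0 i : 0 <= P i by apply: le_trans (Pge i).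
have z0 i j : 0 <= z i j by exact: dpsi_ge0.
have zP i j : 0 < a i -> 0 < b j -> z i j <= M + kappa p / P i.
  move=> ai bj; have Pi : 0 < P i by exact: lt_le_trans (Pge i).
  have [zM|/ltW Mz] := leP (z i j) M.
    by apply: le_trans zM _; rewrite lerDl divr_ge0// ltW.
  have zz i' : 0 < a i' -> grp i' = grp i -> z i j <= kappa p * z i' j.
    move=> ai' gi; apply: (dpsi_compare p1 M1 Mz).
    have ff : f i - f i' <= r.
      by apply: (optimal_lipschitz p1 eps0 wb fg ai' ai) => k; exact: Cr.
    have CC : C i' j - C i j < r by apply: Cr.
    (* The potential and the cost each change by at most r, so the slack drops by at most 2 r / eps,
       which is within M^(p-1) / 2. *)
    rewrite /slack -subr_le0 -(pmulr_rle0 _ eps0).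
    have -> : eps * ((f i + g j - C i j) / eps - M `^ (p - 1) / 2 -
       (f i' + g j - C i' j) / eps) =
       f i - C i j - f i' + C i' j - eps * M `^ (p - 1) / 2.
      by field; rewrite gt_eqF.
    by move: rM ff CC; set e := eps * _ => *; lra.
  apply: (@le_trans _ _ (kappa p / P i)); last by rewrite lerDr; lra.
  rewrite ler_pdivlMr//.
  have <- : kappa p * (\sum_i' a i' * z i' j) = kappa p.
    by have := cols j bj; rewrite /coldef => /eqP; rewrite subr_eq0 => /eqP <-; rewrite mulr1.
  apply: (@le_trans _ _ (kappa p * \sum_(i' | grp i' == grp i) a i' * z i' j)).
    rewrite /P !mulr_sumr; apply: ler_sum => i' /eqP gi.
    have := a0 i'; rewrite le_eqVlt => /predU1P[<-|ai'].
      by rewrite mul0r !mulr0.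
    by rewrite mulrC mulrCA ler_pM2l// zz.
  rewrite ler_pM2l//.
  rewrite [leRHS](bigID (fun i' => grp i' == grp i))/= lerDl.
  by apply: sumr_ge0 => i' _; rewrite mulr_ge0.
have step i : a i * \sum_j b j * z i j ^+ 2 <= M * a i + kappa p * (a i / P i).
  have := a0 i; rewrite le_eqVlt => /predU1P[<-|ai].
    by rewrite !mul0r !mulr0 addr0.
  rewrite (_ : M * a i + _ = a i * (M + kappa p / P i)); last by ring.
  rewrite ler_pM2l//.
  have row1 : \sum_j b j * z i j = 1.
    by have := rows i ai; rewrite /rowdef => /eqP; rewrite subr_eq0 => /eqP <-.
  rewrite -[leRHS]mulr1 -row1 mulr_sumr; apply: ler_sum => j _.
  have := b0 j; rewrite le_eqVlt => /predU1P[<-|bj].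
    by rewrite !mul0r mulr0.
  by rewrite [leRHS]mulrCA ler_pM2l// expr2 ler_wpM2r// zP.
apply: le_trans (ler_sum _ (fun i _ => step i)) _.
rewrite big_split/= -!mulr_sumr a1 mulr1 lerD2l ler_pM2l//.
exact: sum_group_ratio_le.
Qed.

End second_moment.

Lemma density_swap (R : realType) (I J : finType) (p eps : R)
    (C : I -> J -> R) f g i j :
  density p eps (fun j i => C i j) g f j i = density p eps C f g i j.
Proof. by rewrite /density /slack (addrC (g j)). Qed.

Lemma optimal_swap (R : realType) (I J : finType) (p eps : R)
    (C : I -> J -> R) a b f g : optimal p eps C a b f g ->
  optimal p eps (fun j i => C i j) b a g f.
Proof.
move=> [rows cols]; split=> [j bj|i ai].
  rewrite -[RHS](cols _ bj) /rowdef /coldef; congr (_ - _).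
  by apply: eq_bigr => i _; rewrite density_swap.
rewrite -[RHS](rows _ ai) /rowdef /coldef; congr (_ - _).
by apply: eq_bigr => j _; rewrite density_swap.
Qed.

(** The version with groups in the second space, for the case where it is the second support that
    has small covering numbers. *)
Lemma second_moment_swap_le (R : realType) (I J G : finType) (p eps : R)
    (C : I -> J -> R) a b f g (grp : J -> G) (M r : R) :
  1 <= p -> 0 < eps -> weights a -> weights b -> optimal p eps C a b f g ->
  1 <= M ->
  (forall j j', 0 < b j -> 0 < b j' -> grp j = grp j' ->
     forall i, C i j' - C i j < r) ->
  4 * r <= eps * M `^ (p - 1) ->
  \sum_i a i * \sum_j b j * density p eps C f g i j ^+ 2
    <= M + kappa p * #|G|%:R.
Proof.
move=> p1 eps0 wa wb fg M1 Cr rM.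
apply: le_trans (second_moment_le p1 eps0 wb wa (optimal_swap fg) M1 Cr rM).
under eq_bigr do rewrite mulr_sumr.
rewrite exchange_big/= le_eqVlt; apply/orP; left; apply/eqP.
apply: eq_bigr => j _; rewrite mulr_sumr; apply: eq_bigr => i _.
by rewrite density_swap mulrCA.
Qed.

(** * Finite independent samples *)

Section iid_expectation.
Context (R : realType) (K : finType) (n : nat) (a : K -> R).
Hypothesis wa : weights a.
Implicit Types (F G : {ffun 'I_n -> K} -> R) (h : K -> R).

(** The expectation over n independent draws from [a], as a finite sum over label sequences. *)
Definition iidE F : R := \sum_(k : {ffun 'I_n -> K}) (\prod_m a (k m)) * F k.

Lemma iidE_prod (H : 'I_n -> K -> R) :
  iidE (fun k => \prod_m H m (k m)) = \prod_m \sum_x a x * H m x.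
Proof.
by rewrite bigA_distr_bigA; apply: eq_bigr => k _; rewrite big_split.
Qed.

Lemma iidE_cst t : iidE (fun=> t) = t.
Proof.
have E1 : iidE (fun=> 1) = 1.
  transitivity (iidE (fun k => \prod_(m < n) (fun=> 1) (k m))).
    by apply: eq_bigr => k _; congr (_ * _); rewrite big1.
  rewrite (iidE_prod (fun _ _ => 1)) big1// => m _.
  by have [_ a1] := wa; rewrite -[RHS]a1; apply: eq_bigr => x _; rewrite mulr1.
rewrite -[RHS]mulr1 -[in RHS]E1 /iidE mulr_sumr.
by apply: eq_bigr => k _; rewrite mulr1 mulrC.
Qed.

Lemma iidED F G : iidE (fun k => F k + G k) = iidE F + iidE G.
Proof. by rewrite /iidE -big_split; apply: eq_bigr => k _; rewrite mulrDr. Qed.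

Lemma iidEZ t F : iidE (fun k => t * F k) = t * iidE F.
Proof. by rewrite /iidE mulr_sumr; apply: eq_bigr => k _; rewrite mulrCA. Qed.

Lemma iidE_sum (I : finType) (F : I -> {ffun 'I_n -> K} -> R) :
  iidE (fun k => \sum_i F i k) = \sum_i iidE (F i).
Proof.
by rewrite /iidE exchange_big/=; apply: eq_bigr => k _; rewrite mulr_sumr.
Qed.

Lemma iidE_le F G : (forall k : {ffun 'I_n -> K}, (forall m, 0 < a (k m)) -> F k <= G k) ->
  iidE F <= iidE G.
Proof.
move=> FG; apply: ler_sum => k _; have [a0 _] := wa.
have [kpos|] := boolP [forall m, 0 < a (k m)].
  by apply: ler_wpM2l; [exact: prodr_ge0|exact: FG (forallP kpos)].
rewrite negb_forall => /existsP[m]; rewrite -leNgt => am.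
have am0 : a (k m) = 0 by apply/eqP; rewrite eq_le am a0.
by rewrite (bigD1 m)//= am0 !mul0r.
Qed.

Lemma iidE1 h m : iidE (fun k => h (k m)) = \sum_x a x * h x.
Proof.
transitivity (iidE (fun k => \prod_m' (if m' == m then h else fun=> 1) (k m'))).
  apply: eq_bigr => k _; congr (_ * _); rewrite (bigD1 m)//= eqxx big1 ?mulr1//.
  by move=> i /negPf ->.
rewrite (iidE_prod (fun m' => if m' == m then h else fun=> 1)).
rewrite (bigD1 m)//= eqxx [X in _ * X]big1 ?mulr1// => i /negPf ->.
by have [_ a1] := wa; rewrite -[RHS]a1; apply: eq_bigr => x _; rewrite mulr1.
Qed.

Lemma iidE2 h m m' : m != m' ->
  iidE (fun k => h (k m) * h (k m')) = (\sum_x a x * h x) ^+ 2.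
Proof.
move=> mm'.
transitivity (iidE (fun k =>
    \prod_i (if (i == m) || (i == m') then h else fun=> 1) (k i))).
  apply: eq_bigr => k _; congr (_ * _); rewrite (bigD1 m)//= eqxx/=.
  rewrite (bigD1 m')/= ?(eq_sym m')// eqxx orbT big1 ?mulr1//.
  by move=> i /andP[/negPf -> /negPf ->].
rewrite (iidE_prod (fun i => if (i == m) || (i == m') then h else fun=> 1)).
rewrite (bigD1 m)//= eqxx/= (bigD1 m')/= ?(eq_sym m')// eqxx orbT.
rewrite [X in _ * (_ * X)]big1 ?mulr1// => i /andP[/negPf -> /negPf ->] /=.
by have [_ a1] := wa; rewrite -[RHS]a1; apply: eq_bigr => x _; rewrite mulr1.
Qed.

(** Cross terms are products of independent centered draws and vanish; the n diagonal terms
    remain. *)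
Lemma iidE_variance h : \sum_x a x * h x = 0 ->
  iidE (fun k => (\sum_m h (k m)) ^+ 2) = n%:R * \sum_x a x * h x ^+ 2.
Proof.
move=> h0; transitivity (iidE (fun k => \sum_m \sum_m' h (k m) * h (k m'))).
  apply: eq_bigr => k _; congr (_ * _); rewrite expr2 mulr_suml.
  by apply: eq_bigr => m _; rewrite mulr_sumr.
rewrite iidE_sum; transitivity (\sum_(m < n) \sum_x a x * h x ^+ 2); last first.
  by rewrite sumr_const card_ord mulr_natl.
apply: eq_bigr => m _; rewrite iidE_sum (bigD1 m)//= big1 ?addr0.
  transitivity (iidE (fun k => h (k m) ^+ 2)).
    by apply: eq_bigr => k _; rewrite expr2.
  exact: (iidE1 (fun x => h x ^+ 2)).
by move=> m' mm'; rewrite iidE2 1?eq_sym// h0 expr0n.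
Qed.

End iid_expectation.

Section empirical_weights.
Context (R : realType) (K : finType) (n : nat).
Implicit Types (k : {ffun 'I_n.+1 -> K}) (h : K -> R).

Definition emp k (x : K) : R := n.+1%:R^-1 * \sum_m (k m == x)%:R.

Lemma sum_emp k h : \sum_x emp k x * h x = n.+1%:R^-1 * \sum_m h (k m).
Proof.
rewrite /emp; under eq_bigr do rewrite -mulrA mulr_suml.
rewrite -mulr_sumr exchange_big/=; congr (_ * _); apply: eq_bigr => m _.
rewrite (bigD1 (k m))//= eqxx mul1r big1 ?addr0// => x.
by rewrite eq_sym => /negPf ->; rewrite mul0r.
Qed.

Lemma weights_emp k : weights (emp k).
Proof.
split=> [x|]; first by rewrite mulr_ge0// sumr_ge0.
transitivity (\sum_x emp k x * 1); first by apply: eq_bigr => x _; rewrite mulr1.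
by rewrite sum_emp sumr_const card_ord mulVf// pnatr_eq0.
Qed.

Lemma iidE_emp (a : K -> R) h : weights a ->
  iidE a (fun k : {ffun 'I_n.+1 -> K} => \sum_x emp k x * h x) = \sum_x a x * h x.
Proof.
move=> wa; transitivity (iidE a (fun k : {ffun 'I_n.+1 -> K} =>
   n.+1%:R^-1 * \sum_m h (k m))).
  by apply: eq_bigr => k _; rewrite sum_emp.
rewrite iidEZ iidE_sum; under eq_bigr do rewrite iidE1//.
by rewrite sumr_const card_ord -[X in _ * X]mulr_natl mulKf// pnatr_eq0.
Qed.

End empirical_weights.

(* Replaces Cauchy-Schwarz in bounding the expected fluctuations: [t] is chosen
   in terms of the second moment. *)
Lemma norm_le_square (R : realType) (t x : R) : 0 < t ->
  `|x| <= t / 2 * x ^+ 2 + t^-1 / 2.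
Proof.
move=> t0; rewrite -(ler_pM2l t0).
have -> : t * (t / 2 * x ^+ 2 + t^-1 / 2) = ((t * `|x|) ^+ 2 + 1) / 2.
  by rewrite exprMn real_normK ?num_real//; field; rewrite gt_eqF.
rewrite ler_pdivlMr//; have := sqr_ge0 (t * `|x| - 1).
by rewrite sqrrB; move: (t * _) => y; rewrite expr2 mulr1; lra.
Qed.

(** * The bias of the finite dual problem *)

Section bias.
Context (R : realType) (p eps : R).
Hypotheses (p1 : 1 <= p) (eps0 : 0 < eps).

Lemma iidE_exchange (I J : finType) (m n : nat) (a : I -> R) (b : J -> R)
    (F : {ffun 'I_m -> I} -> {ffun 'I_n -> J} -> R) :
  iidE a (fun k => iidE b (F k)) = iidE b (fun l => iidE a (F^~ l)).
Proof.
rewrite /iidE; under eq_bigr do rewrite mulr_sumr.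
rewrite exchange_big/=; apply: eq_bigr => l _; rewrite mulr_sumr.
by apply: eq_bigr => k _; rewrite mulrCA.
Qed.

(** On a row of positive mass the empirical defect is the mean of n + 1 independent copies of 1 - z,
    centered since the row sums to 1 under [b]. Its variance is at most the second moment of the row
    over n + 1. The row is averaged with [emp R k], which is independent of the defect and has mean
    [a]. *)
Lemma row_fluctuation (I J : finType) (n : nat) (C : I -> J -> R) a b f g (L : R) :
  weights a -> weights b -> optimal p eps C a b f g ->
  0 < L -> \sum_i a i * \sum_j b j * density p eps C f g i j ^+ 2 <= L ->
  iidE a (fun k : {ffun 'I_n.+1 -> I} =>
    iidE b (fun l : {ffun 'I_n.+1 -> J} =>
      \sum_i emp R k i * `|rowdef p eps C (emp R l) f g i|))
  <= Num.sqrt L / Num.sqrt n.+1%:R.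
Proof.
move=> wa wb [rows _] L0 zL; have [a0 a1] := wa; have [b0 b1] := wb.
set N : R := n.+1%:R; have N0 : 0 < N by rewrite ltr0n.
pose z := density p eps C f g.
pose V i := iidE b (fun l : {ffun 'I_n.+1 -> J} =>
  rowdef p eps C (emp R l) f g i ^+ 2).
have VE i : 0 < a i -> V i <= N^-1 * \sum_j b j * z i j ^+ 2.
  move=> ai.
  have row1 : \sum_j b j * z i j = 1.
    by have := rows i ai; rewrite /rowdef => /eqP; rewrite subr_eq0 => /eqP <-.
  pose h j := 1 - z i j.
  have h0 : \sum_j b j * h j = 0.
    under eq_bigr do rewrite mulrBr mulr1.
    by rewrite sumrB b1 row1 subrr.
  have -> : V i = N^-1 ^+ 2 * iidE b (fun l : {ffun 'I_n.+1 -> J} =>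
      (\sum_m h (l m)) ^+ 2).
    rewrite -iidEZ; apply: eq_bigr => l _; congr (_ * _).
    rewrite -exprMn; congr (_ ^+ 2).
    rewrite /rowdef sum_emp /h sumrB sumr_const card_ord mulrBr.
    by rewrite mulVf// pnatr_eq0.
  rewrite (iidE_variance n.+1 wb h0) -/N mulrA expr2 mulfVK ?gt_eqF//.
  rewrite ler_pM2l ?invr_gt0//.
  have -> : \sum_j b j * h j ^+ 2 = \sum_j b j * z i j ^+ 2 - 1.
    transitivity (\sum_j (b j * z i j ^+ 2 + (b j - 2 * (b j * z i j)))).
      by apply: eq_bigr => j _; rewrite /h; ring.
    by rewrite big_split/= sumrB -mulr_sumr b1 row1; congr (_ + _); ring.
  by rewrite lerBlDr lerDl ler01.
have N1 : N^-1 != 0 by rewrite invr_eq0 gt_eqF.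
have sV : \sum_i a i * V i <= N^-1 * L.
  apply: le_trans (_ : _ <= N^-1 * \sum_i a i * \sum_j b j * z i j ^+ 2) _.
    rewrite mulr_sumr; apply: ler_sum => i _; rewrite mulrCA.
    have := a0 i; rewrite le_eqVlt => /predU1P[<-|ai]; first by rewrite !mul0r.
    by rewrite ler_pM2l// VE.
  by rewrite ler_pM2l// invr_gt0.
pose sL := Num.sqrt L; pose sN := Num.sqrt N.
have sL0 : 0 < sL by rewrite sqrtr_gt0.
have sN0 : 0 < sN by rewrite sqrtr_gt0.
(* The minimizer of t/2 * (L/N) + 1/(2t), with minimum sqrt(L/N). *)
pose t := sN / sL.
have t0 : 0 < t by rewrite divr_gt0.
have -> : sL / sN = t / 2 * (N^-1 * L) + t^-1 / 2.
  rewrite -(sqr_sqrtr (ltW N0)) -(sqr_sqrtr (ltW L0)) -/sL -/sN /t.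
  by field; rewrite !gt_eqF.
apply: (@le_trans _ _ (iidE a (fun k : {ffun 'I_n.+1 -> I} =>
    iidE b (fun l : {ffun 'I_n.+1 -> J} => t / 2 *
      (\sum_i emp R k i * rowdef p eps C (emp R l) f g i ^+ 2) + t^-1 / 2)))).
  apply: (iidE_le wa) => k _; apply: (iidE_le wb) => l _.
  have [e0 e1] := weights_emp R k.
  rewrite [X in _ + X](_ : _ = \sum_i emp R k i * (t^-1 / 2)); last first.
    by rewrite -mulr_suml e1 mul1r.
  rewrite mulr_sumr -big_split/=.
  apply: ler_sum => i _; rewrite mulrCA -mulrDr; apply: ler_wpM2l => //.
  exact: norm_le_square.
rewrite (_ : iidE a _ = t / 2 * (\sum_i a i * V i) + t^-1 / 2); last first.
  rewrite -(iidE_emp n V wa) -[X in _ + X](iidE_cst n.+1 wa) -iidEZ -iidED.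
  apply: eq_bigr => k _; congr (_ * _).
  rewrite iidED iidEZ iidE_cst// iidE_sum; congr (_ * _ + _).
  by apply: eq_bigr => i _; rewrite iidEZ.
by rewrite lerD2r ler_pM2l// divr_gt0.
Qed.

Lemma coldef_swap (I J : finType) (C : I -> J -> R) a f g j :
  rowdef p eps (fun j i => C i j) a g f j = coldef p eps C a f g j.
Proof.
by rewrite /rowdef /coldef; congr (_ - _); apply: eq_bigr => i _;
  rewrite density_swap.
Qed.

Lemma col_fluctuation (I J : finType) (n : nat) (C : I -> J -> R) a b f g (L : R) :
  weights a -> weights b -> optimal p eps C a b f g ->
  0 < L -> \sum_i a i * \sum_j b j * density p eps C f g i j ^+ 2 <= L ->
  iidE a (fun k : {ffun 'I_n.+1 -> I} =>
    iidE b (fun l : {ffun 'I_n.+1 -> J} =>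
      \sum_j emp R l j * `|coldef p eps C (emp R k) f g j|))
  <= Num.sqrt L / Num.sqrt n.+1%:R.
Proof.
move=> wa wb fg L0 zL; rewrite iidE_exchange.
have zL' : \sum_j b j * \sum_i a i *
    density p eps (fun j i => C i j) g f j i ^+ 2 <= L.
  apply: le_trans zL; rewrite le_eqVlt; apply/orP; left; apply/eqP.
  under eq_bigr do rewrite mulr_sumr.
  rewrite exchange_big/=; apply: eq_bigr => i _; rewrite mulr_sumr.
  by apply: eq_bigr => j _; rewrite density_swap mulrCA.
apply: le_trans (row_fluctuation n wb wa (optimal_swap fg) L0 zL').
rewrite le_eqVlt; apply/orP; left; apply/eqP.
apply: eq_bigr => l _; congr (_ * _); apply: eq_bigr => k _; congr (_ * _).
by apply: eq_bigr => j _; rewrite coldef_swap.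
Qed.

(** For fixed potentials the dual is affine in each of the two weight vectors, and the empirical
    ones are unbiased and independent of each other. *)
Lemma iidE_dual (I J : finType) (n : nat) (C : I -> J -> R) a b f g :
  weights a -> weights b ->
  iidE a (fun k : {ffun 'I_n.+1 -> I} => iidE b (fun l : {ffun 'I_n.+1 -> J} =>
      dual p eps C (emp R k) (emp R l) f g))
  = dual p eps C a b f g.
Proof.
move=> wa wb; rewrite /dual.
pose W (v : J -> R) i := \sum_j v j * psi p (slack eps C f g i j).
have dE (u : I -> R) (v : J -> R) : \sum_i u i * f i + \sum_j v j * g j
    - eps * (\sum_i \sum_j u i * v j * psi p (slack eps C f g i j)) =
    \sum_i u i * f i + (\sum_j v j * g j + - eps * \sum_i u i * W v i).
  rewrite -addrA; congr (_ + (_ + _)); rewrite -mulNr; congr (_ * _).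
  apply: eq_bigr => i _; rewrite /W mulr_sumr.
  by apply: eq_bigr => j _; rewrite mulrA.
rewrite dE.
transitivity (iidE a (fun k : {ffun 'I_n.+1 -> I} =>
   \sum_i emp R k i * f i + (\sum_j b j * g j + - eps * \sum_i emp R k i * W b i))).
  apply: eq_bigr => k _; congr (_ * _).
  transitivity (iidE b (fun l : {ffun 'I_n.+1 -> J} => \sum_i emp R k i * f i
    + (\sum_j emp R l j * g j + - eps * \sum_i emp R k i * W (emp R l) i))).
    by apply: eq_bigr => l _; rewrite dE.
  rewrite iidED iidE_cst// iidED iidE_emp// iidEZ iidE_sum.
  congr (_ + (_ + _ * _)); apply: eq_bigr => i _.
  by rewrite iidEZ /W iidE_emp.
by rewrite iidED iidE_emp// iidED iidE_cst// iidEZ iidE_emp.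
Qed.

(** On each sample [(fh, gh)] does at least as well as [(f, g)], whence the lower bound. The gain is
    limited by [dual_concave] at [(f, g)], where the increments of the potentials are at most [A]
    and [B]. *)
Lemma finite_bias (I J : finType) (n : nat) (C : I -> J -> R) a b f g (L A B : R)
    (fh : {ffun 'I_n.+1 -> I} -> {ffun 'I_n.+1 -> J} -> I -> R)
    (gh : {ffun 'I_n.+1 -> I} -> {ffun 'I_n.+1 -> J} -> J -> R) :
  weights a -> weights b -> optimal p eps C a b f g ->
  (forall k l, optimal p eps C (emp R k) (emp R l) (fh k l) (gh k l)) ->
  (forall k l i, `|fh k l i - f i| <= A) ->
  (forall k l j, `|gh k l j - g j| <= B) ->
  0 < A -> 0 < B ->
  0 < L -> \sum_i a i * \sum_j b j * density p eps C f g i j ^+ 2 <= L ->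
  0 <= iidE a (fun k => iidE b (fun l =>
      dual p eps C (emp R k) (emp R l) (fh k l) (gh k l))) - dual p eps C a b f g
  <= (A + B) * (Num.sqrt L / Num.sqrt n.+1%:R).
Proof.
move=> wa wb fg fgh fA gB A0 B0 L0 zL; rewrite -(iidE_dual n C f g wa wb).
apply/andP; split.
  rewrite subr_ge0; apply: (iidE_le wa) => k _; apply: (iidE_le wb) => l _.
  exact: (dual_le_optimal p1 eps0 f g (weights_emp R k) (weights_emp R l) (fgh k l)).
rewrite lerBlDl mulrDl.
apply: (@le_trans _ _ (iidE a (fun k : {ffun 'I_n.+1 -> I} => iidE b (fun l =>
   dual p eps C (emp R k) (emp R l) f g
   + (A * (\sum_i emp R k i * `|rowdef p eps C (emp R l) f g i|)
   + B * (\sum_j emp R l j * `|coldef p eps C (emp R k) f g j|)))))).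
  apply: (iidE_le wa) => k _; apply: (iidE_le wb) => l _.
  have [e0 _] := weights_emp R k; have [e0' _] := weights_emp R l.
  apply: le_trans (dual_concave C p1 eps0 f g (fh k l) (gh k l) e0 e0') _.
  rewrite -addrA lerD2l; apply: lerD; rewrite mulr_sumr; apply: ler_sum => x _.
    rewrite [leRHS]mulrCA; apply: ler_wpM2l => //.
    by apply: le_trans (ler_norm _) _; rewrite normrM ler_wpM2r.
  rewrite [leRHS]mulrCA; apply: ler_wpM2l => //.
  by apply: le_trans (ler_norm _) _; rewrite normrM ler_wpM2r.
pose X (k : {ffun 'I_n.+1 -> I}) (l : {ffun 'I_n.+1 -> J}) :=
  dual p eps C (emp R k) (emp R l) f g.
pose Y (k : {ffun 'I_n.+1 -> I}) (l : {ffun 'I_n.+1 -> J}) :=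
  \sum_i emp R k i * `|rowdef p eps C (emp R l) f g i|.
pose Z (k : {ffun 'I_n.+1 -> I}) (l : {ffun 'I_n.+1 -> J}) :=
  \sum_j emp R l j * `|coldef p eps C (emp R k) f g j|.
have -> : iidE a (fun k => iidE b (fun l => X k l + (A * Y k l + B * Z k l))) =
   iidE a (fun k => iidE b (X k)) + (A * iidE a (fun k => iidE b (Y k))
     + B * iidE a (fun k => iidE b (Z k))).
  rewrite -!iidEZ -!iidED; apply: eq_bigr => k _; congr (_ * _).
  by rewrite -!iidEZ -!iidED.
rewrite lerD2l; apply: lerD; rewrite ler_pM2l//.
  exact: row_fluctuation.
exact: col_fluctuation.
Qed.

End bias.

(** * Reduction of optimal transport to the finite problem *)

(* The library integral of an arbitrary function is a difference of suprema of
   integrals of simple functions, hence monotone without measurability. So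
   neither the cost nor the empirical transport value need be shown
   measurable: they are squeezed between functions of finitely many cells. *)
Section nonmeasurable_monotone.
Context d (T : measurableType d) (R : realType).
Local Open Scope ereal_scope.
Variable mu : {measure set T -> \bar R}.
Implicit Types f g F : T -> \bar R.

Lemma le_integral_pointwise f g : (forall x, f x <= g x) ->
  \int[mu]_x f x <= \int[mu]_x g x.
Proof.
move=> fg; rewrite integralE [leRHS]integralE.
have mono (u v : T -> \bar R) : (forall x, 0 <= u x) -> (forall x, 0 <= v x) ->
    (forall x, u x <= v x) -> \int[mu]_x u x <= \int[mu]_x v x.
  move=> u0 v0 uv; rewrite !ge0_integralTE//.
  apply: le_ereal_sup => _ [h hu <-]; exists h => // x.
  exact: le_trans (hu x) (uv x).
apply: leeB; apply: mono => x //.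
  by apply: (@funepos_le _ _ setT) => [y _|]; [exact: fg|rewrite inE].
by apply: (@funeneg_le _ _ setT) => [y _|]; [exact: fg|rewrite inE].
Qed.

(** Setting [F] to an infinite value on a null set turns an inequality off that set into one that
    holds everywhere. *)
Lemma integral_patch_null (N : set T) (v : \bar R) F : measurable N -> mu N = 0 ->
  measurable_fun setT F ->
  \int[mu]_x (if x \in N then v else F x) = \int[mu]_x F x.
Proof.
move=> mN N0 mF; apply: ae_eq_integral => //.
  apply: measurable_fun_ifT => //.
  apply: (measurable_fun_bool true); rewrite setTI.
  rewrite (_ : _ @^-1` _ = N)//.
  by apply/seteqP; split=> x /= xN; [exact: set_mem|exact: mem_set].
exists N; split => // x /= h; apply: contrapT => xN; apply: h => _.
by case: ifPn => //; rewrite inE.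
Qed.

Lemma ae_le_integral_any (N : set T) F f : measurable N -> mu N = 0 ->
  measurable_fun setT F -> (forall x, ~ N x -> F x <= f x) ->
  \int[mu]_x F x <= \int[mu]_x f x.
Proof.
move=> mN N0 mF Ff; rewrite -(integral_patch_null -oo mN N0 mF).
apply: le_integral_pointwise => x; case: ifPn => [_|]; first exact: leNye.
by rewrite notin_setE; exact: Ff.
Qed.

Lemma ae_ge_integral_any (N : set T) F f : measurable N -> mu N = 0 ->
  measurable_fun setT F -> (forall x, ~ N x -> f x <= F x) ->
  \int[mu]_x f x <= \int[mu]_x F x.
Proof.
move=> mN N0 mF Ff; rewrite -(integral_patch_null +oo mN N0 mF).
apply: le_integral_pointwise => x; case: ifPn => [_|]; first exact: leey.
by rewrite notin_setE; exact: Ff.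
Qed.

End nonmeasurable_monotone.

(** * Measurable partitions, encoded by the map from points to cell labels *)

Definition cells d (T : measurableType d) (K : Type) (h : T -> K) :=
  forall x, measurable (h @^-1` [set x]).

Section cells.
Context d (T : measurableType d) (R : realType) (K : finType) (h : T -> K).
Variable mu : probability T R.
Hypothesis mh : cells h.
Implicit Type F : K -> R.

Definition mass (x : K) : R := fine (mu (h @^-1` [set x])).

Lemma massE x : (mass x)%:E = mu (h @^-1` [set x]).
Proof. by rewrite fineK// fin_num_measure//; exact: mh. Qed.

Lemma cells_sum_indic F t :
  F (h t) = \sum_x F x * \1_(h @^-1` [set x]) t.
Proof.
rewrite (bigD1 (h t))//= indicE mem_set//= mulr1 big1 ?addr0// => x xt.
by rewrite indicE memNset ?mulr0//= => htx; move: xt; rewrite -htx eqxx.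
Qed.

Lemma measurable_cells F : measurable_fun setT (fun t => F (h t)).
Proof.
rewrite (_ : (fun t => F (h t)) = fun t => \sum_x F x * \1_(h @^-1` [set x]) t);
  last by apply/funext => t; exact: cells_sum_indic.
apply: measurable_sum => x; apply: measurable_funM => //.
Qed.

Let integrable_cell (F : K -> R) x :
  mu.-integrable setT (fun t => (F x * \1_(h @^-1` [set x]) t)%:E).
Proof.
under eq_fun do rewrite EFinM.
by apply: integrableZl => //; exact: integrable_indic.
Qed.

Lemma integrable_cells F : mu.-integrable setT (fun t => (F (h t))%:E).
Proof.
under eq_fun do rewrite cells_sum_indic -sumEFin.
by apply: integrable_sum => // x _; exact: integrable_cell.
Qed.

Lemma integral_cells_in F (D : set T) : measurable D ->
  (\int[mu]_(t in D) (F (h t))%:E =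
   (\sum_x F x * fine (mu (h @^-1` [set x] `&` D)))%:E)%E.
Proof.
move=> mD; under eq_integral do rewrite cells_sum_indic -sumEFin.
rewrite (integral_sum mD); last first.
  by move=> x; apply: integrableS (integrable_cell F x).
rewrite -sumEFin; apply: eq_bigr => x _.
under eq_integral do rewrite EFinM.
rewrite integralZl//; last by apply: integrableS (integrable_indic _ _).
rewrite integral_indic// EFinM fineK// fin_num_measure//.
exact: measurableI.
Qed.

Lemma integral_cells F :
  (\int[mu]_t (F (h t))%:E = (\sum_x mass x * F x)%:E)%E.
Proof.
rewrite integral_cells_in//; congr EFin; apply: eq_bigr => x _.
by rewrite setIT mulrC.
Qed.

Lemma weights_mass : weights mass.
Proof.
split=> [x|]; first by rewrite /mass fine_ge0.
apply: EFin_inj; transitivity (\sum_x mass x * 1)%:E.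
  by congr EFin; apply: eq_bigr => x _; rewrite mulr1.
rewrite -(integral_cells (fun=> 1)) integral_cst// mul1e.
exact: probability_setT.
Qed.

End cells.

(** * Densities and Radon-Nikodym derivatives *)

Definition probability_density d (T : measurableType d) (R : realType)
    (rho : probability T R) (z : T -> R) :=
  [/\ measurable_fun setT z, forall x, 0 <= z x &
      (\int[rho]_x (z x)%:E = 1)%E].

Section with_density.
Context d (T : measurableType d) (R : realType).
Variables (rho : probability T R) (z : T -> R).
Local Open Scope ereal_scope.

(* The argument [hz] is there for the inference of the probability structure. *)
Definition with_density (hz : probability_density rho z) (A : set T) : \bar R :=
  \int[rho]_(x in A) (z x)%:E.

Variable hz : probability_density rho z.

Let with_density0 : with_density hz set0 = 0.
Proof. exact: integral_set0. Qed.

Let with_density_ge0 A : 0 <= with_density hz A.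
Proof. by have [_ z0 _] := hz; apply: integral_ge0 => x _; rewrite lee_fin. Qed.

Let with_density_sigma_additive : semi_sigma_additive (with_density hz).
Proof.
have [mz z0 _] := hz; apply: semi_sigma_additive_nng_induced.
  exact/measurable_EFinP.
by move=> x; rewrite lee_fin.
Qed.

HB.instance Definition _ := isMeasure.Build _ _ _ (with_density hz)
  with_density0 with_density_ge0 with_density_sigma_additive.

Let with_density_setT : with_density hz setT = 1.
Proof. by have [] := hz. Qed.

HB.instance Definition _ :=
  Measure_isProbability.Build _ _ _ (with_density hz) with_density_setT.

Lemma with_density_dominates : with_density hz `<< rho.
Proof.
have [mz z0 _] := hz; apply/null_content_dominatesP => A mA A0.
apply: null_set_integral => //.
by apply: measurable_funTS; exact/measurable_EFinP.
Qed.

End with_density.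

Section Radon_Nikodym_real.
Context d (T : measurableType d) (R : realType).
Variables (pi rho : probability T R).
Hypothesis ac : pi `<< rho.
Local Open Scope ereal_scope.
Local Open Scope charge_scope.
Local Notation rn := ('d (charge_of_finite_measure pi) '/d rho).

(** The derivative is taken for a charge and carries no sign by itself; it agrees almost everywhere
    with the nonnegative derivative built for measures. *)
Lemma Radon_Nikodym_ae_ge0 : exists N, [/\ measurable N, rho N = 0 &
  forall x, ~ N x -> (0 <= fine (rn x))%R].
Proof.
have [N [mN N0 HN]] := ae_eq_Radon_Nikodym_SigmaFinite ac measurableT.
exists N; split => // x xN.
have /= -> // : rn x = Radon_Nikodym_SigmaFinite.f pi rho x.
  by apply: contrapT => h; apply: xN; apply: HN => /= /(_ I) /esym.
by rewrite fine_ge0// Radon_Nikodym_SigmaFinite.f_ge0.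
Qed.

Lemma integral_mul_Radon_Nikodym (u : T -> R) :
  pi.-integrable setT (EFin \o u) ->
  \int[rho]_x (u x * fine (rn x))%:E = \int[pi]_x (u x)%:E.
Proof.
move=> iu; rewrite -(Radon_Nikodym_change_of_variables ac measurableT iu).
apply: eq_integral => x _; rewrite EFinM fineK//.
exact: Radon_Nikodym_fin_num.
Qed.

Lemma integrable_mul_Radon_Nikodym (u : T -> R) : measurable_fun setT u ->
  [bounded u x | x in [set: T]] ->
  rho.-integrable setT (fun x => (u x * fine (rn x))%:E).
Proof.
move=> mu bu; rewrite (_ : (fun x => _) = (EFin \o u) \* rn).
  by apply: integrableMr => //; exact: Radon_Nikodym_integrable.
by apply/funext => x /=; rewrite EFinM fineK//; exact: Radon_Nikodym_fin_num.
Qed.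

End Radon_Nikodym_real.

Lemma Radon_Nikodym_with_density d (T : measurableType d) (R : realType)
    (rho : probability T R) (z : T -> R) (hz : probability_density rho z) :
  exists N, [/\ measurable N, rho N = 0%E & forall x, ~ N x ->
    fine (Radon_Nikodym (charge_of_finite_measure (with_density hz)) rho x)
      = z x].
Proof.
have ac := with_density_dominates hz.
have [mz z0 _] := hz.
have [|||N [mN N0 HN]] := @integral_ae_eq _ _ _ rho setT measurableT (EFin \o z)
  (Radon_Nikodym (charge_of_finite_measure (with_density hz)) rho).
- exact: Radon_Nikodym_integrable.
- exact/measurable_EFinP.
- by move=> E _ mE; rewrite -Radon_Nikodym_integral.
exists N; split => // x xN.
suff -> : Radon_Nikodym (charge_of_finite_measure (with_density hz)) rho x
  = (z x)%:E by [].
by apply: contrapT => h; apply: xN; apply: HN => /= /(_ I).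
Qed.

(** * Lower bound on the transport value by weak duality *)

Section reduction.
Context d1 d2 (T1 : measurableType d1) (T2 : measurableType d2) (R : realType).
Context (I J : finType) (k : T1 -> I) (l : T2 -> J).
Hypotheses (mk : cells k) (ml : cells l).
Implicit Types (mu : probability T1 R) (nu : probability T2 R).

Lemma bounded_cells (T : Type) (K : finType) (h : T -> K) (F : K -> R) :
  [bounded F (h t) | t in [set: T]].
Proof.
exists (\sum_x `|F x|); split; first exact: num_real.
move=> M FM t _; apply: le_trans (ltW FM).
by rewrite (bigD1 (h t))//= lerDl sumr_ge0.
Qed.

Definition pair_cell (z : T1 * T2) : I * J := (k z.1, l z.2).

Lemma pair_cell_preimage x :
  pair_cell @^-1` [set x] = (k @^-1` [set x.1]) `*` (l @^-1` [set x.2]).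
Proof.
case: x => i j; apply/seteqP; split => -[x y] /=; first by case=> <- <-.
by case=> /= e1 e2; rewrite /pair_cell/= e1 e2.
Qed.

Lemma cells_pair : cells pair_cell.
Proof. by move=> x; rewrite pair_cell_preimage; exact: measurableX. Qed.

Lemma cells_fst : cells (fun z : T1 * T2 => k z.1).
Proof.
move=> i; rewrite (_ : _ @^-1` _ = (k @^-1` [set i]) `*` setT).
  exact: measurableX.
by apply/seteqP; split => -[x y] //= [].
Qed.

Lemma cells_snd : cells (fun z : T1 * T2 => l z.2).
Proof.
move=> j; rewrite (_ : _ @^-1` _ = setT `*` (l @^-1` [set j])).
  exact: measurableX.
by apply/seteqP; split => -[x y] //= [].
Qed.

Lemma mass_prod mu nu x :
  mass pair_cell (mu \x nu)%E x = mass k mu x.1 * mass l nu x.2.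
Proof.
apply: EFin_inj; rewrite EFinM !massE//; last exact: cells_pair.
rewrite pair_cell_preimage.
exact: (product_measure1E mu nu (mk _) (ml _)).
Qed.

Lemma mass_fst mu nu pi f : coupling mu nu pi ->
  \sum_x mass pair_cell pi x * f x.1 = \sum_i mass k mu i * f i.
Proof.
move=> [cmu _]; apply: EFin_inj.
rewrite -(integral_cells pi cells_pair (fun x => f x.1)).
transitivity (\int[pi]_z (f (k z.1))%:E)%E => //.
rewrite (integral_cells pi cells_fst f); congr EFin; apply: eq_bigr => i _.
congr (_ * _); apply: EFin_inj; rewrite !massE//; last exact: cells_fst.
rewrite -[RHS]cmu//; congr (pi _).
by apply/seteqP; split => -[x y] //= [].
Qed.

Lemma mass_snd mu nu pi g : coupling mu nu pi ->
  \sum_x mass pair_cell pi x * g x.2 = \sum_j mass l nu j * g j.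
Proof.
move=> [_ cnu]; apply: EFin_inj.
rewrite -(integral_cells pi cells_pair (fun x => g x.2)).
transitivity (\int[pi]_z (g (l z.2))%:E)%E => //.
rewrite (integral_cells pi cells_snd g); congr EFin; apply: eq_bigr => j _.
congr (_ * _); apply: EFin_inj; rewrite !massE//; last exact: cells_snd.
rewrite -[RHS]cnu//; congr (pi _).
by apply/seteqP; split => -[x y] //= [].
Qed.

Lemma coupling_null mu nu pi (N1 : set T1) (N2 : set T2) :
  measurable N1 -> measurable N2 -> mu N1 = 0%E -> nu N2 = 0%E ->
  coupling mu nu pi -> pi ((N1 `*` setT) `|` (setT `*` N2)) = 0%E.
Proof.
move=> mN1 mN2 muN1 nuN2 [cmu cnu]; apply/eqP; rewrite -measure_le0.
have <- : (pi (N1 `*` setT) + pi (setT `*` N2) = 0)%E.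
  by rewrite cmu// cnu// muN1 nuN2 adde0.
by apply: measureU2; exact: measurableX.
Qed.

Context (p eps : R) (C : I -> J -> R) (c : T1 * T2 -> R) (eta : R).
Hypotheses (p1 : 1 <= p) (eps0 : 0 < eps).
Context (mu : probability T1 R) (nu : probability T2 R).
Context (N1 : set T1) (N2 : set T2).
Hypotheses (mN1 : measurable N1) (mN2 : measurable N2).
Hypotheses (muN1 : mu N1 = 0%E) (nuN2 : nu N2 = 0%E).
Hypothesis cC : forall x y, ~ N1 x -> ~ N2 y ->
  `|c (x, y) - C (k x) (l y)| <= eta.

Local Notation a := (mass k mu).
Local Notation b := (mass l nu).
Let N := (N1 `*` setT) `|` (setT `*` N2).

Let mN : measurable N.
Proof. by apply: measurableU; exact: measurableX. Qed.

Let piN pi : coupling mu nu pi -> pi N = 0%E.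
Proof. exact: coupling_null. Qed.

Let cN x y : ~ N (x, y) -> `|c (x, y) - C (k x) (l y)| <= eta.
Proof.
by move=> nN; apply: cC => h; apply: nN; [left|right].
Qed.

(** Weak duality, for arbitrary potentials: Fenchel-Young at the slack bounds the divergence of any
    coupling from below by a term linear in the coupling, which combines with the cost, and the
    conjugate term of the dual. *)
Lemma dual_le_OT f g :
  ((dual p eps C a b f g - eta)%:E <= OT (phi_p p) eps c mu nu)%E.
Proof.
apply: le_ereal_inf_tmp => _ [pi cpi <-].
set w := mass pair_cell pi.
have costE : ((\sum_x w x * C x.1 x.2 - eta)%:E <= \int[pi]_z (c z)%:E)%E.
  have -> : \sum_x w x * C x.1 x.2 - eta = \sum_x w x * (C x.1 x.2 - eta).
    have [_ w1] := weights_mass pi cells_pair.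
    by under [RHS]eq_bigr do rewrite mulrBr; rewrite sumrB -mulr_suml w1 mul1r.
  rewrite -(integral_cells pi cells_pair (fun x => C x.1 x.2 - eta)).
  apply: (ae_le_integral_any mN (piN cpi)).
    apply/measurable_EFinP.
    exact: (measurable_cells cells_pair (fun x => C x.1 x.2 - eta)).
  move=> [x y] xyN; rewrite lee_fin /=.
  by have := cN xyN; rewrite ler_norml => /andP[]; lra.
(* Without absolute continuity the divergence is [+oo]; as the cost integral is not [-oo] by
   [costE], the sum is [+oo]. *)
rewrite /divergence; case: asboolP => [ac|_]; last first.
  rewrite gt0_muley ?lte_fin// addey ?leey//.
  by rewrite -ltNye (lt_le_trans _ costE)// ltNyr.
pose s (x : I * J) := slack eps C f g x.1 x.2.
set h := Radon_Nikodym _ _.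
have divE : ((\sum_x w x * s x - \sum_x a x.1 * b x.2 * psi p (s x))%:E <=
    \int[(mu \x nu)%E]_z (phi_p p (fine (h z)))%:E)%E.
  have [N' [mN' N'0 h0]] := Radon_Nikodym_ae_ge0 ac.
  have ish : (mu \x nu)%E.-integrable setT
      (fun z => (s (pair_cell z) * fine (h z))%:E).
    apply: (integrable_mul_Radon_Nikodym ac (u := fun z => s (pair_cell z))).
      exact: measurable_cells cells_pair s.
    exact: bounded_cells.
  have -> : (\sum_x w x * s x - \sum_x a x.1 * b x.2 * psi p (s x))%:E =
     (\int[(mu \x nu)%E]_z (s (pair_cell z) * fine (h z)
        - psi p (s (pair_cell z)))%:E)%E.
    rewrite EFinB; under [RHS]eq_integral do rewrite EFinB.
    rewrite integralB//; last exact: (integrable_cells _ cells_pair (fun x => psi p (s x))).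
    rewrite (integral_mul_Radon_Nikodym ac (u := fun z => s (pair_cell z)));
      last exact: (integrable_cells pi cells_pair s).
    rewrite (integral_cells pi cells_pair s).
    rewrite (integral_cells _ cells_pair (fun x => psi p (s x))).
    congr (_ - _)%E; congr EFin; apply: eq_bigr => x _.
    by rewrite mass_prod.
  apply: (ae_le_integral_any mN' N'0).
    apply/measurable_EFinP; apply: measurable_funB.
      by apply/measurable_EFinP; exact: measurable_int ish.
    exact: (measurable_cells cells_pair (fun x => psi p (s x))).
  by move=> z zN'; rewrite lee_fin; apply: fenchel_young => //; exact: h0.
have := leeD costE (lee_wpmul2l (ltW eps0 : (0 <= eps%:E)%E) divE).
apply: le_trans; rewrite -EFinM -EFinD lee_fin le_eqVlt; apply/orP; left.
apply/eqP; rewrite mulrBr.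
(* [eps] times the slack is f + g - C, and the marginals of [pi] turn the first two terms into the
   linear part of the dual. *)
have -> : eps * (\sum_x w x * s x) = \sum_i a i * f i + \sum_j b j * g j
    - \sum_x w x * C x.1 x.2.
  rewrite -(mass_fst f cpi) -(mass_snd g cpi) -/w mulr_sumr -big_split -sumrB/=.
  by apply: eq_bigr => x _; rewrite /s /slack; field; rewrite gt_eqF.
have -> : \sum_x a x.1 * b x.2 * psi p (s x) =
    \sum_i \sum_j a i * b j * psi p (slack eps C f g i j).
  by rewrite pair_big.
rewrite /dual; ring.
Qed.

End reduction.

(** * Upper bound by the coupling built from optimal potentials *)

Lemma sum_mass_in d (T : measurableType d) (R : realType) (K : finType)
    (h : T -> K) (mu : probability T R) (A : set T) : cells h -> measurable A ->
  mu A = (\sum_x fine (mu (h @^-1` [set x] `&` A)))%:E.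
Proof.
move=> mh mA; have := integral_cells_in mu mh (fun=> 1) mA.
rewrite integral_cst// mul1e => ->; congr EFin.
by apply: eq_bigr => x _; rewrite mul1r.
Qed.

Lemma mass_in_le d (T : measurableType d) (R : realType) (K : finType)
    (h : T -> K) (mu : probability T R) (A : set T) x : cells h -> measurable A ->
  fine (mu (h @^-1` [set x] `&` A)) <= mass h mu x.
Proof.
move=> mh mA; have mhA : measurable (h @^-1` [set x] `&` A) by exact: measurableI.
rewrite /mass fine_le ?fin_num_measure//.
by apply: le_measure; rewrite ?inE//; exact: subIsetl.
Qed.

Section reduction_upper.
Context d1 d2 (T1 : measurableType d1) (T2 : measurableType d2) (R : realType).
Context (I J : finType) (k : T1 -> I) (l : T2 -> J).
Hypotheses (mk : cells k) (ml : cells l).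
Context (p eps : R) (C : I -> J -> R) (c : T1 * T2 -> R) (eta : R).
Hypotheses (p1 : 1 <= p) (eps0 : 0 < eps).
Context (mu : probability T1 R) (nu : probability T2 R).
Context (N1 : set T1) (N2 : set T2).
Hypotheses (mN1 : measurable N1) (mN2 : measurable N2).
Hypotheses (muN1 : mu N1 = 0%E) (nuN2 : nu N2 = 0%E).
Hypothesis cC : forall x y, ~ N1 x -> ~ N2 y ->
  `|c (x, y) - C (k x) (l y)| <= eta.

Local Notation a := (mass k mu).
Local Notation b := (mass l nu).
Context (f : I -> R) (g : J -> R).
Hypothesis fg : optimal p eps C a b f g.
Local Notation z := (density p eps C f g).
Local Notation cell := (pair_cell k l).
Let zz (t : T1 * T2) : R := z (cell t).1 (cell t).2.

Let row_sum i : 0 < a i -> \sum_j b j * z i j = 1.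
Proof.
by move=> ai; have := fg.1 i ai; rewrite /rowdef => /eqP; rewrite subr_eq0 => /eqP <-.
Qed.

Let col_sum j : 0 < b j -> \sum_i a i * z i j = 1.
Proof.
by move=> bj; have := fg.2 j bj; rewrite /coldef => /eqP; rewrite subr_eq0 => /eqP <-.
Qed.

Let wa : weights a. Proof. exact: weights_mass. Qed.
Let wb : weights b. Proof. exact: weights_mass. Qed.

(** To be used with [u i] the mass of the part of cell [i] inside a measurable set, which gives the
    first marginal of the coupling on every such set. *)
Let sum_row_mul (u : I -> R) : (forall i, 0 <= u i <= a i) ->
  \sum_i \sum_j u i * b j * z i j = \sum_i u i.
Proof.
move=> ua; apply: eq_bigr => i _.
under eq_bigr do rewrite -mulrA.
rewrite -mulr_sumr; have /andP[u0 ui] := ua i.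
have [a0 _] := wa; have := a0 i; rewrite le_eqVlt => /predU1P[ai|ai].
  suff -> : u i = 0 by rewrite mul0r.
  by apply/eqP; rewrite eq_le u0 andbT ai.
by rewrite row_sum// mulr1.
Qed.

Let sum_col_mul (v : J -> R) : (forall j, 0 <= v j <= b j) ->
  \sum_i \sum_j a i * v j * z i j = \sum_j v j.
Proof.
move=> vb; rewrite exchange_big; apply: eq_bigr => j _ /=.
under eq_bigr do rewrite mulrAC mulrC.
rewrite -mulr_sumr; have /andP[v0 vj] := vb j.
have [b0 _] := wb; have := b0 j; rewrite le_eqVlt => /predU1P[bj|bj].
  suff -> : v j = 0 by rewrite mul0r.
  by apply/eqP; rewrite eq_le v0 andbT bj.
by rewrite col_sum// mulr1.
Qed.

Let mcell : cells cell := cells_pair mk ml.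

Let integral_rect (A : set T1) (B : set T2) : measurable A -> measurable B ->
  (\int[(mu \x nu)%E]_(t in A `*` B) (zz t)%:E =
   (\sum_i \sum_j fine (mu (k @^-1` [set i] `&` A)) *
      fine (nu (l @^-1` [set j] `&` B)) * z i j)%:E)%E.
Proof.
move=> mA mB.
rewrite (integral_cells_in _ mcell (fun x => z x.1 x.2)); last exact: measurableX.
rewrite pair_big/=; congr EFin; apply: eq_bigr => -[i j] _ /=; rewrite mulrC.
congr (_ * _); rewrite pair_cell_preimage/= -setXI.
rewrite (product_measure1E mu nu); [|exact: measurableI..].
by rewrite fineM// fin_num_measure//; exact: measurableI.
Qed.

Let hz : probability_density (mu \x nu)%E zz.
Proof.
split.
- exact: (measurable_cells mcell (fun x => z x.1 x.2)).
- by move=> t; exact: dpsi_ge0.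
rewrite -setXTT integral_rect//; congr EFin.
have [a0 a1] := wa.
rewrite -[RHS]a1 -(sum_row_mul (u := a)); last by move=> i; rewrite a0 lexx.
by apply: eq_bigr => i _; apply: eq_bigr => j _; rewrite !setIT.
Qed.

Let pi : probability (T1 * T2)%type R := with_density hz.

Let cpi : coupling mu nu pi.
Proof.
split=> [A mA|B mB].
  transitivity (\int[(mu \x nu)%E]_(t in A `*` setT) (zz t)%:E)%E => //.
  rewrite integral_rect// (sum_mass_in mu mk mA); congr EFin.
  rewrite -[RHS]sum_row_mul; last first.
    by move=> i; rewrite fine_ge0//=; exact: mass_in_le.
  by apply: eq_bigr => i _; apply: eq_bigr => j _; rewrite setIT.
transitivity (\int[(mu \x nu)%E]_(t in setT `*` B) (zz t)%:E)%E => //.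
rewrite integral_rect// (sum_mass_in nu ml mB); congr EFin.
rewrite -[RHS]sum_col_mul; last first.
  by move=> j; rewrite fine_ge0//=; exact: mass_in_le.
by apply: eq_bigr => i _; apply: eq_bigr => j _; rewrite setIT.
Qed.

Let mass_pi x : mass cell pi x = a x.1 * b x.2 * z x.1 x.2.
Proof.
rewrite /mass; transitivity (fine (\int[(mu \x nu)%E]_(t in cell @^-1` [set x])
   (zz t)%:E)%E) => //.
rewrite (eq_integral (fun=> (z x.1 x.2)%:E)).
  rewrite integral_cst//.
  transitivity (fine ((z x.1 x.2)%:E * (a x.1 * b x.2)%:E)%E).
    by congr (fine (_ * _)%E); rewrite -(mass_prod mk ml mu nu) massE.
  by rewrite -EFinM/= mulrC.
by move=> t; rewrite inE => /= tx; rewrite /zz tx.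
Qed.

(** For the coupling with density z, equality holds in Fenchel-Young on every cell, so its primal
    value for the cell cost is the dual value; the given cost adds at most [eta]. *)
Lemma OT_le_dual : (OT (phi_p p) eps c mu nu <= (dual p eps C a b f g + eta)%:E)%E.
Proof.
apply: ge_ereal_inf; exists (\int[pi]_t (c t)%:E
  + eps%:E * divergence (phi_p p) pi (mu \x nu))%E; first by exists pi.
have costE : (\int[pi]_t (c t)%:E <= (\sum_x mass cell pi x * C x.1 x.2 + eta)%:E)%E.
  have -> : \sum_x mass cell pi x * C x.1 x.2 + eta =
      \sum_x mass cell pi x * (C x.1 x.2 + eta).
    have [_ w1] := weights_mass pi mcell.
    by under [RHS]eq_bigr do rewrite mulrDr; rewrite big_split/= -mulr_suml w1 mul1r.
  rewrite -(integral_cells pi mcell (fun x => C x.1 x.2 + eta)).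
  pose N := (N1 `*` setT) `|` (setT `*` N2).
  apply: (@ae_ge_integral_any _ _ _ pi N).
  - by apply: measurableU; exact: measurableX.
  - exact: coupling_null cpi.
  - apply/measurable_EFinP.
    exact: (measurable_cells mcell (fun x => C x.1 x.2 + eta)).
  move=> [x y] xyN; rewrite lee_fin /=.
  have : `|c (x, y) - C (k x) (l y)| <= eta.
    by apply: cC => h; apply: xyN; [left|right].
  by rewrite ler_norml => /andP[]; lra.
have divE : (divergence (phi_p p) pi (mu \x nu) <=
    (\sum_x a x.1 * b x.2 * phi_p p (z x.1 x.2))%:E)%E.
  rewrite /divergence; case: asboolP => [_|[]]; last exact: with_density_dominates.
  have [N [mN N0 HN]] := Radon_Nikodym_with_density hz.
  rewrite (_ : (\sum_x _)%:E = (\int[(mu \x nu)%E]_t (phi_p p (zz t))%:E)%E).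
    apply: (ae_ge_integral_any mN N0).
      apply/measurable_EFinP.
      exact: (measurable_cells mcell (fun x => phi_p p (z x.1 x.2))).
    by move=> t tN; rewrite HN.
  rewrite (integral_cells _ mcell (fun x => phi_p p (z x.1 x.2))).
  by congr EFin; apply: eq_bigr => x _; rewrite mass_prod.
have := leeD costE (lee_wpmul2l (ltW eps0 : (0 <= eps%:E)%E) divE).
move=> /le_trans; apply; rewrite -EFinM -EFinD lee_fin le_eqVlt; apply/orP; left.
apply/eqP.
have -> : eps * (\sum_x a x.1 * b x.2 * phi_p p (z x.1 x.2)) =
    \sum_i a i * f i + \sum_j b j * g j
    - \sum_x mass cell pi x * C x.1 x.2
    - eps * \sum_x a x.1 * b x.2 * psi p (slack eps C f g x.1 x.2).
  rewrite -(mass_fst mk ml f cpi) -(mass_snd mk ml g cpi) !mulr_sumr.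
  rewrite -big_split -!sumrB/=; apply: eq_bigr => x _.
  rewrite mass_pi /density phi_p_dpsi.
  by rewrite {1}/slack; field; rewrite gt_eqF.
have -> : \sum_x a x.1 * b x.2 * psi p (slack eps C f g x.1 x.2) =
    \sum_i \sum_j a i * b j * psi p (slack eps C f g i j).
  by rewrite pair_big.
rewrite /dual; ring.
Qed.

End reduction_upper.

(** * Sampling *)

Section empirical_mass.
Context d (T : measurableType d) (R : realType) (n : nat).
Implicit Types x : 'I_n.+1 -> T.

Lemma mass_empirical (K : finType) (h : T -> K) x :
  mass h (empirical (R := R) x) = emp R [ffun i => h (x i)].
Proof.
apply/funext => y; rewrite /emp.
transitivity (fine (empirical (R := R) x (h @^-1` [set y]))) => //.
rewrite /empirical.
rewrite (eq_bigr (fun m => ((h (x m) == y)%:R : R)%:E)).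
  rewrite sumEFin -EFinM/=; congr (_ * _).
  by apply: eq_bigr => m _; rewrite ffunE.
move=> m _; rewrite diracE; congr ((nat_of_bool _)%:R%:E).
by apply/idP/eqP => [|hm]; rewrite inE.
Qed.

Lemma empirical_null x (N : set T) : (forall i, ~ N (x i)) ->
  empirical (R := R) x N = 0%E.
Proof.
move=> xN; rewrite /empirical big1 ?mule0// => i _.
by rewrite diracE memNset.
Qed.

End empirical_mass.

Section sampling.
Context dS (S : measurableType dS) dT (T : measurableType dT) (R : realType).
Context (Pr : probability S R) (P Q : probability T R) (n : nat).
Context (X Y : 'I_n.+1 -> {RV Pr >-> T}).
Hypothesis XY : two_sample P Q X Y.
Context (I J : finType) (k : T -> I) (l : T -> J).
Hypotheses (mk : cells k) (ml : cells l).
Local Notation a := (mass k P).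
Local Notation b := (mass l Q).

Definition sample_cell (w : S) : {ffun 'I_n.+1 -> I} * {ffun 'I_n.+1 -> J} :=
  ([ffun i => k (X i w)], [ffun j => l (Y j w)]).

Let cellset (u : {ffun 'I_n.+1 -> I}) (v : {ffun 'I_n.+1 -> J})
    (s : 'I_n.+1 + 'I_n.+1) : set T :=
  match s with inl i => k @^-1` [set u i] | inr j => l @^-1` [set v j] end.

Let mcellset u v s : measurable (cellset u v s).
Proof. by case: s => [i|j]; [exact: mk|exact: ml]. Qed.

Lemma sample_cell_preimage u v : sample_cell @^-1` [set (u, v)] =
  \bigcap_(s in [set` [set: 'I_n.+1 + 'I_n.+1]%SET])
    (pooled X Y s @^-1` cellset u v s).
Proof.
apply/seteqP; split => w /=.
  by case=> <- <- [i|j] _ /=; rewrite ffunE.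
move=> h; congr (_, _); apply/ffunP => i; rewrite ffunE.
  by apply: (h (inl i)); rewrite /= inE.
by apply: (h (inr i)); rewrite /= inE.
Qed.

Lemma cells_sample : cells sample_cell.
Proof.
move=> [u v]; rewrite sample_cell_preimage; apply: fin_bigcap_measurable.
  exact: finite_finset.
by move=> s _; apply: measurable_funPTI; exact: mcellset.
Qed.

(** Independence of the pooled sample enters here: the labels have a product law, and expectations
    of functions of labels become [iidE]. *)
Lemma mass_sample u v :
  mass sample_cell Pr (u, v) = (\prod_m a (u m)) * (\prod_m b (v m)).
Proof.
have [lX lY indep] := XY.
apply: EFin_inj; rewrite massE; last exact: cells_sample.
rewrite sample_cell_preimage indep; last by move=> s; exact: mcellset.
rewrite EFinM -!prodEFin.
under eq_bigl do rewrite inE.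
rewrite big_sumType/=; congr (_ * _)%E; apply: eq_bigr => m _.
  by rewrite massE//; exact: lX.
by rewrite massE//; exact: lY.
Qed.

Lemma integral_sample (F : {ffun 'I_n.+1 -> I} -> {ffun 'I_n.+1 -> J} -> R) :
  (\int[Pr]_w (F (sample_cell w).1 (sample_cell w).2)%:E =
   (iidE a (fun u => iidE b (F u)))%:E)%E.
Proof.
rewrite (integral_cells Pr cells_sample (fun x => F x.1 x.2)); congr EFin.
rewrite /iidE; under [RHS]eq_bigr do rewrite mulr_sumr.
rewrite pair_big/=; apply: eq_bigr => -[u v] _.
by rewrite mass_sample/= mulrA.
Qed.

Context (p eps : R) (C : I -> J -> R) (c : T * T -> R) (eta : R).
Hypotheses (p1 : 1 <= p) (eps0 : 0 < eps).
Context (N1 N2 : set T).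
Hypotheses (mN1 : measurable N1) (mN2 : measurable N2).
Hypotheses (PN1 : P N1 = 0%E) (QN2 : Q N2 = 0%E).
Hypothesis cC : forall x y, ~ N1 x -> ~ N2 y ->
  `|c (x, y) - C (k x) (l y)| <= eta.

(** The event that some sample point falls in a null set. The union runs over [nat]; indices beyond
    n are sent by [inord] to an index already present. *)
Let Z : set S := \bigcup_(m : nat)
  (X (inord m) @^-1` N1 `|` Y (inord m) @^-1` N2).

Let mZ : measurable Z.
Proof.
apply: bigcup_measurable => m _.
by apply: measurableU; apply: measurable_funPTI.
Qed.

Let Z0 : Pr Z = 0%E.
Proof.
have [lX lY _] := XY.
suff : Pr.-negligible Z by move/negligibleP; apply.
apply: negligible_bigcup => m; apply: negligibleU.
  exists (X (inord m) @^-1` N1); split => //; first exact: measurable_funPTI.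
  by rewrite -PN1; exact: lX.
exists (Y (inord m) @^-1` N2); split => //; first exact: measurable_funPTI.
by rewrite -QN2; exact: lY.
Qed.

Let ZX w i : ~ Z w -> ~ N1 (X i w).
Proof. by move=> Zw N1X; apply: Zw; exists (val i) => //; left; rewrite inord_val. Qed.

Let ZY w i : ~ Z w -> ~ N2 (Y i w).
Proof. by move=> Zw N1Y; apply: Zw; exists (val i) => //; right; rewrite inord_val. Qed.

Context (f : I -> R) (g : J -> R).
Context (fh : {ffun 'I_n.+1 -> I} -> {ffun 'I_n.+1 -> J} -> I -> R)
        (gh : {ffun 'I_n.+1 -> I} -> {ffun 'I_n.+1 -> J} -> J -> R).
Context (L A B : R).
Hypotheses (fg : optimal p eps C a b f g)
  (fgh : forall u v, optimal p eps C (emp R u) (emp R v) (fh u v) (gh u v))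
  (fA : forall u v i, `|fh u v i - f i| <= A)
  (gB : forall u v j, `|gh u v j - g j| <= B)
  (A0 : 0 < A) (B0 : 0 < B) (L0 : 0 < L)
  (zL : \sum_i a i * \sum_j b j * density p eps C f g i j ^+ 2 <= L).

Let OTw w : \bar R := OT (phi_p p) eps c (empirical (fun i => X i w))
                        (empirical (fun j => Y j w)).

Let V u v := dual p eps C (emp R u) (emp R v) (fh u v) (gh u v).

Let V_le w : ~ Z w ->
  ((V (sample_cell w).1 (sample_cell w).2 - eta)%:E <= OTw w)%E.
Proof.
move=> Zw; rewrite /V /= -!mass_empirical.
apply: (@dual_le_OT _ _ _ _ _ _ _ _ _ mk ml _ _ _ _ _ p1 eps0 _ _ N1 N2) => //.
  by apply: empirical_null => i; exact: ZX.
by apply: empirical_null => i; exact: ZY.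
Qed.

Let le_V w : ~ Z w ->
  (OTw w <= (V (sample_cell w).1 (sample_cell w).2 + eta)%:E)%E.
Proof.
move=> Zw.
have opt : optimal p eps C (mass k (empirical (R := R) (fun i => X i w)))
    (mass l (empirical (R := R) (fun j => Y j w)))
    (fh (sample_cell w).1 (sample_cell w).2)
    (gh (sample_cell w).1 (sample_cell w).2).
  by rewrite !mass_empirical; exact: fgh.
have e1 : empirical (R := R) (fun i => X i w) N1 = 0%E.
  by apply: empirical_null => i; exact: ZX.
have e2 : empirical (R := R) (fun j => Y j w) N2 = 0%E.
  by apply: empirical_null => i; exact: ZY.
have := OT_le_dual mk ml eps0 mN1 mN2 e1 e2 cC opt.
by rewrite !mass_empirical.
Qed.

(** Off [Z] the empirical transport value is within [eta] of the empirical dual optimum, and [OT] at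
    [(P, Q)] is within [eta] of its own; the rest is [finite_bias]. *)
Lemma sampling_bias :
  (`| \int[Pr]_w OTw w - OT (phi_p p) eps c P Q | <=
   ((A + B) * (Num.sqrt L / Num.sqrt n.+1%:R) + 2 * eta)%:E)%E.
Proof.
have wa : weights a := weights_mass P mk.
have wb : weights b := weights_mass Q ml.
pose EV := iidE a (fun u => iidE b (V u)).
pose D := dual p eps C a b f g.
have /andP[EV0 EV1] := finite_bias p1 eps0 wa wb fg fgh fA gB A0 B0 L0 zL.
have lo : ((EV - eta)%:E <= \int[Pr]_w OTw w)%E.
  have -> : EV - eta = iidE a (fun u => iidE b (fun v => V u v - eta)).
    transitivity (iidE a (fun u => iidE b (V u) - eta)).
      by rewrite iidED iidE_cst.
    by apply: eq_bigr => u _; rewrite iidED iidE_cst.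
  rewrite -integral_sample; apply: (ae_le_integral_any mZ Z0) => //.
  apply/measurable_EFinP.
  exact: (measurable_cells cells_sample (fun x => V x.1 x.2 - eta)).
have hi : (\int[Pr]_w OTw w <= (EV + eta)%:E)%E.
  have -> : EV + eta = iidE a (fun u => iidE b (fun v => V u v + eta)).
    transitivity (iidE a (fun u => iidE b (V u) + eta)).
      by rewrite iidED iidE_cst.
    by apply: eq_bigr => u _; rewrite iidED iidE_cst.
  rewrite -integral_sample; apply: (ae_ge_integral_any mZ Z0) => //.
  apply/measurable_EFinP.
  exact: (measurable_cells cells_sample (fun x => V x.1 x.2 + eta)).
have lo' := dual_le_OT mk ml p1 eps0 mN1 mN2 PN1 QN2 cC f g.
have hi' := OT_le_dual mk ml eps0 mN1 mN2 PN1 QN2 cC fg.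
rewrite -/D in lo' hi'; rewrite -/EV -/D in EV0 EV1.
move: lo hi lo' hi'.
(* The two-sided bounds exclude infinite values. *)
case: (\int[Pr]_w OTw w)%E => [x| |] //; rewrite ?leye_eq ?leeNy_eq//.
case: (OT _ _ _ _ _) => [y| |] //; rewrite ?leye_eq ?leeNy_eq//.
rewrite -EFinB abse_EFin !lee_fin => lo hi lo' hi'.
rewrite ler_norml; apply/andP; split; lra.
Qed.

End sampling.

(** * Partitions of subsets of Euclidean space *)

Section signature.
Context d (T : measurableType d).

(** Turns a finite family of overlapping sets into a partition: the nonempty fibres are the atoms of
    the algebra it generates. *)
Definition signature m (U : 'I_m -> set T) (x : T) : {ffun 'I_m -> bool} :=
  [ffun i => `[< U i x >]].

Lemma signatureP m (U : 'I_m -> set T) x i : reflect (U i x) (signature U x i).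
Proof. by rewrite ffunE; exact: asboolP. Qed.

Lemma cells_signature m (U : 'I_m -> set T) :
  (forall i, measurable (U i)) -> cells (signature U).
Proof.
move=> mU s.
rewrite (_ : _ @^-1` _ = \bigcap_(i in [set: 'I_m]) (if s i then U i else ~` U i)).
  apply: fin_bigcap_measurable; first exact: finite_finset.
  by move=> i _; case: (s i) => //; exact: measurableC.
apply/seteqP; split => x /=.
  by move=> <- i _; case: signatureP.
move=> h; apply/ffunP => i; rewrite ffunE; have := h i I.
by case: (s i) => Ux; apply/asboolP.
Qed.

Lemma cells_prod (K K' : Type) (h : T -> K) (h' : T -> K') :
  cells h -> cells h' -> cells (fun x => (h x, h' x)).
Proof.
move=> ch ch' [y y'].
rewrite (_ : _ @^-1` _ = (h @^-1` [set y]) `&` (h' @^-1` [set y'])).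
  exact: measurableI.
by apply/seteqP; split => x /=; [case=> -> ->|case=> -> ->].
Qed.

End signature.

Section euclidean.
Context (R : realType) (d : nat).
Local Notation E := 'rV[R]_d.
Implicit Types (x y v : E) (Om : set E) (r : R).

Lemma enorm0 : enorm (0 : E) = 0.
Proof. by rewrite /enorm big1 ?sqrtr0// => i _; rewrite mxE expr0n. Qed.

Lemma enorm_ge0 x : 0 <= enorm x.
Proof. exact: sqrtr_ge0. Qed.

Lemma enorm_distC x y : enorm (x - y) = enorm (y - x).
Proof.
rewrite /enorm; congr Num.sqrt; apply: eq_bigr => i _.
by rewrite !mxE -sqrrN opprB.
Qed.

Lemma eball_center x r : 0 < r -> eball x r x.
Proof. by move=> r0; rewrite /eball/= subrr enorm0. Qed.

(** The topology is that of the sup norm, so openness comes from the continuity of the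
    coordinates. *)
Lemma open_eball x r : open (eball x r).
Proof.
have ci (y : E) i : (fun z : E => (z - x) ord0 i) @ y --> (y - x) ord0 i.
  rewrite (_ : (fun z : E => (z - x) ord0 i) =
    (fun z : E => z ord0 i - x ord0 i)); last first.
    by apply/funext => z; rewrite !mxE.
  have -> : (y - x) ord0 i = y ord0 i - x ord0 i by rewrite !mxE.
  have cy : (fun z : E => z ord0 i) @ y --> y ord0 i by exact: coord_continuous.
  apply: (@cvgB _ _ _ (nbhs y) (nbhs_filter y)
    (fun z : E => z ord0 i) (fun=> x ord0 i)) => //; exact: cvg_cst.
have cn (y : E) : (fun z : E => enorm (z - x)) @ y --> enorm (y - x).
  apply: (cvg_comp (fun z : E => \sum_(i < d) (z - x) ord0 i ^+ 2)
    (@Num.sqrt R)); last exact: sqrt_continuous.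
  apply: (@cvg_rsum _ _ E (nbhs y) _
    (fun i z => (z - x) ord0 i ^+ 2) (fun i => (y - x) ord0 i ^+ 2)) => i.
  exact: (@cvgM _ _ (nbhs y) (nbhs_filter y) _ _ _ _ (ci y i) (ci y i)).
apply: (@open_comp _ _ (fun z : E => enorm (z - x)) [set t | t < r]).
  by move=> y _; exact: cn.
exact: open_lt.
Qed.

Lemma measurable_eball x r : measurable (eball x r).
Proof. by apply: sub_sigma_algebra; exact: open_eball. Qed.

(** The set lies in a compact cube, and the balls around all points form an open cover of it. *)
Lemma bounded_finite_cover Om r : bounded_set Om -> 0 < r ->
  exists m (v : 'I_m -> E), Om `<=` \bigcup_(i in [set: 'I_m]) eball (v i) r.
Proof.
move=> [M [_ OmM]] r0.
pose K : set E := [set v : E | forall i, `[- (M + 1), M + 1]%classic (v ord0 i)].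
have cK : compact K.
  apply: (@rV_compact _ _ (fun=> `[- (M + 1), M + 1]%classic)) => i.
  exact: segment_compact.
have OmK : Om `<=` K.
  move=> x Omx i /=; rewrite in_itv/= -ler_norml.
  have xM : `|x| <= M + 1 by apply: OmM => //; rewrite ltrDl.
  apply: le_trans xM; rewrite [leRHS]/Num.norm/= mx_normrE.
  by apply/bigmax_geP; right; exists (ord0, i).
move: cK; rewrite compact_cover => /(_ E setT (fun v => eball v r)) [].
- by move=> v _; exact: open_eball.
- by move=> x _; exists x => //; exact: eball_center.
move=> D _ KD; pose s : seq E := finmap.enum_fset D.
exists (size s), (fun i => nth 0 s i) => x /OmK/KD[v /= vD xv].
have iD : (index v s < size s)%N by rewrite index_mem.
by exists (Ordinal iD) => //=; rewrite nth_index.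
Qed.

(** Two scales at once: cells record membership in fine balls of radius r, which control the cost
    error, and in the given balls of radius delta. The group of a cell is one ball of radius delta
    that contains it, or [None]. *)
Lemma partition_exists Om r N (w : 'I_N -> E) (delta : R) :
  bounded_set Om -> 0 < r ->
  exists (I : finType) (k : E -> I) (grp : I -> option 'I_N),
    [/\ cells k,
      forall x y, Om x -> k x = k y -> exists v, eball v r x /\ eball v r y &
      forall x y, (exists i, eball (w i) delta x) ->
        grp (k x) = grp (k y) ->
        exists i, eball (w i) delta x /\ eball (w i) delta y].
Proof.
move=> bOm r0; have [m [v Omv]] := bounded_finite_cover bOm r0.
pose U i := eball (v i) r; pose W i := eball (w i) delta.
exists ({ffun 'I_m -> bool} * {ffun 'I_N -> bool})%type.
exists (fun x => (signature U x, signature W x)), (fun s =>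
  [pick i | (s.2 : {ffun 'I_N -> bool}) i]).
split.
- by apply: cells_prod; apply: cells_signature => i; exact: measurable_eball.
- move=> x y /Omv[i _ xi] [/ffunP/(_ i) sxy _]; exists (v i); split => //.
  by apply/(signatureP U); rewrite -sxy; apply/signatureP.
- move=> x y [i /(signatureP W) xi] /=.
  case: pickP => [j xj|/(_ i)]; last by rewrite xi.
  case: pickP => // j' yj' [jj']; exists j; split; first exact/(signatureP W).
  by rewrite jj'; exact/(signatureP W).
Qed.

End euclidean.

(** * Minkowski dimension and Lipschitz costs *)

Section minkowski.
Context (R : realType) (d : nat).
Local Notation E := 'rV[R]_d.
Implicit Types (Om : set E) (r alpha : R).

Lemma covering_number_ge1 Om r : Om !=set0 -> (1 <= covering_number Om r)%E.
Proof.
move=> [x Omx]; apply: le_ereal_inf_tmp => _ [N [w _ Omw] <-].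
rewrite lee_fin ler1n; have [i _ _] := Omw x Omx.
by case: N i {w Omw} => [[]|].
Qed.

(** For small r the logarithm of the covering number is below alpha ln(1/r). It is nonnegative for a
    nonempty set, which forces alpha > 0. *)
Lemma minkowski_covering Om alpha : Om !=set0 ->
  (minkowski_dim Om < alpha%:E)%E -> 0 < alpha /\
  exists r0, 0 < r0 /\ forall r, 0 < r < r0 ->
    exists N, is_covering Om r N /\ N%:R <= r `^ (- alpha).
Proof.
(* The upper limit is an infimum of suprema over neighbourhoods, one of which is already below
   alpha. *)
move=> Om0 /ereal_inf_lt[_ [V V0 <-] Valpha].
have {V0}[r0 /= r00 V0] := V0.
(* Radii below 1 have - ln r > 0, so the quotient can be cleared. *)
have r1 : 0 < Num.min r0 1 by rewrite lt_min r00 ltr01.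
have key r : 0 < r < Num.min r0 1 ->
    [/\ 0 < - ln r, (lne (covering_number Om r) < (alpha * - ln r)%:E)%E &
      (0 <= lne (covering_number Om r))%E].
  move=> /andP[rp]; rewrite lt_min => /andP[rr0 rr1].
  have lr : 0 < - ln r by rewrite oppr_gt0 ln_lt0// rp.
  have Vr : V r by apply: V0 => //=; rewrite sub0r normrN gtr0_norm.
  split => //; last by rewrite lne_ge0; exact: covering_number_ge1.
  have : (lne (covering_number Om r) * ((- ln r)^-1)%:E < alpha%:E)%E.
    by apply: le_lt_trans Valpha; apply: ereal_sup_ubound; exists r.
  by rewrite lte_pdivrMr.
split.
  have m2 : 0 < Num.min r0 1 / 2 < Num.min r0 1.
    by rewrite divr_gt0//= ltr_pdivrMr// ltr_pMr// ltr1n.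
  have [lr h1 h2] := key _ m2.
  by have := le_lt_trans h2 h1; rewrite lte_fin pmulr_lgt0.
exists (Num.min r0 1); split => // r rr.
have [lr h1 h2] := key r rr; have /andP[rp _] := rr.
have : (covering_number Om r < (r `^ (- alpha))%:E)%E.
  have -> : covering_number Om r = expeR (lne (covering_number Om r)).
    apply/esym/eqP; rewrite lneK_eq.
    by apply: le_trans (covering_number_ge1 r Om0); exact: lee01.
  have -> : r `^ (- alpha) = expR (alpha * - ln r).
    by rewrite /powR gt_eqF// mulrN mulNr.
  by rewrite -[ltRHS]/(expeR (alpha * - ln r)%:E) lte_expeR.
move=> /ereal_inf_lt[_ [N cN <-]]; rewrite lte_fin => /ltW Nr.
by exists N.
Qed.

Lemma lipschitz_cost_bound (c : E * E -> R) : lipschitz_cost c ->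
  exists L, [/\ 0 < L,
    forall x x' y, `|c (x, y) - c (x', y)| <= L * enorm (x - x') &
    forall x y y', `|c (x, y) - c (x, y')| <= L * enorm (y - y')].
Proof.
(* The given constant may fail to be positive. *)
move=> [L cL]; exists (`|L| + 1); split.
- by rewrite ltr_wpDl.
- move=> x x' y; apply: le_trans (cL (x, y) (x', y)) _.
  rewrite /= subrr enorm0 expr0n addr0 sqrtr_sqr ger0_norm ?enorm_ge0//.
  by apply: ler_wpM2r; [exact: enorm_ge0|rewrite ler_wpDr// ler_norm].
- move=> x y y'; apply: le_trans (cL (x, y) (x, y')) _.
  rewrite /= subrr enorm0 expr0n add0r sqrtr_sqr ger0_norm ?enorm_ge0//.
  by apply: ler_wpM2r; [exact: enorm_ge0|rewrite ler_wpDr// ler_norm].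
Qed.

Lemma cost_bounded (c : E * E -> R) (Om Om' : set E) : lipschitz_cost c ->
  bounded_set Om -> bounded_set Om' ->
  exists M, 0 <= M /\ forall x y, Om x -> Om' y -> `|c (x, y)| <= M.
Proof.
move=> /lipschitz_cost_bound[L [L0 cx cy]] bOm bOm'.
have [m [v Omv]] := bounded_finite_cover bOm ltr01.
have [m' [v' Omv']] := bounded_finite_cover bOm' ltr01.
exists (\sum_i \sum_j `|c (v i, v' j)| + 2 * L); split.
  by apply: addr_ge0; [apply: sumr_ge0 => i _; exact: sumr_ge0|rewrite mulr_ge0// ltW].
move=> x y /Omv[i _ xi] /Omv'[j _ yj].
have h1 : `|c (x, y) - c (v i, y)| <= L.
  by apply: le_trans (cx _ _ _) _; rewrite ger_pMr// ltW.
have h2 : `|c (v i, y) - c (v i, v' j)| <= L.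
  by apply: le_trans (cy _ _ _) _; rewrite ger_pMr// ltW.
have h3 : `|c (v i, v' j)| <= \sum_i \sum_j `|c (v i, v' j)|.
  rewrite (bigD1 i)//= (bigD1 j)//= -addrA lerDl; apply: addr_ge0.
    exact: sumr_ge0.
  by apply: sumr_ge0 => k _; exact: sumr_ge0.
have -> : c (x, y) = (c (x, y) - c (v i, y)) + (c (v i, y) - c (v i, v' j))
  + c (v i, v' j) by ring.
apply: le_trans (ler_normD _ _) _; rewrite addrC; apply: lerD => //.
apply: le_trans (ler_normD _ _) _.
have -> : 2 * L = L + L by ring.
exact: lerD.
Qed.

End minkowski.

(** A cell that misses [Om] gets an arbitrary point of [Om], so that the cost at representatives is
    bounded for all labels. *)
Lemma representatives (T K : Type) (Om : set T) (k : T -> K) : Om !=set0 ->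
  exists rep : K -> T, (forall i, Om (rep i)) /\
    forall x, Om x -> k (rep (k x)) = k x.
Proof.
move=> [x0 Om0].
have /choice[rep repP] : forall i, exists x, Om x /\
    forall y, Om y -> k y = i -> k x = i.
  move=> i; have [[x [Omx kx]]|nx] := pselect (exists x, Om x /\ k x = i).
    by exists x.
  by exists x0; split => // y Omy ky; exfalso; apply: nx; exists y.
exists rep; split => [i|x Omx]; first by have [] := repP i.
by have [_ h] := repP (k x); exact: (h x).
Qed.

Lemma support_nonempty d (T : measurableType d) (R : realType)
    (P : probability T R) (Om : set T) : P.-negligible (~` Om) -> Om !=set0.
Proof.
move=> [A [mA PA sA]]; apply: contrapT => Om0.
have AT : A = setT.
  apply/seteqP; split => // x _; apply: sA => Omx; apply: Om0; by exists x.
by have := probability_setT P; rewrite -AT PA => /eqP; rewrite eqe eq_sym oner_eq0.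
Qed.

Lemma mass_gt0_meets d (T : measurableType d) (R : realType) (K : finType)
    (k : T -> K) (P : probability T R) (N : set T) i : cells k ->
  measurable N -> P N = 0%E -> 0 < mass k P i -> exists x, ~ N x /\ k x = i.
Proof.
move=> mk mN PN mi; apply: contrapT => nx.
have : (P (k @^-1` [set i]) <= P N)%E.
  apply: le_measure; rewrite ?inE// => x /= kx; apply: contrapT => Nx.
  by apply: nx; exists x.
by rewrite PN -massE// lee_fin leNgt mi.
Qed.

(** * The bias at a fixed covering radius *)

Section bias_bound.
Context (R : realType) (d : nat).
Local Notation E := 'rV[R]_d.
Context (P Q : probability E R) (Om Om' : set E) (c : E * E -> R) (p L M : R).
Hypotheses (bOm : bounded_set Om) (bOm' : bounded_set Om').
Hypotheses (POm : P.-negligible (~` Om)) (QOm' : Q.-negligible (~` Om')).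
Hypotheses (L0 : 0 < L) (M0 : 0 <= M) (p1 : 1 <= p).
Hypothesis cx : forall x x' y, `|c (x, y) - c (x', y)| <= L * enorm (x - x').
Hypothesis cy : forall x y y', `|c (x, y) - c (x, y')| <= L * enorm (y - y').
Hypothesis cM : forall x y, Om x -> Om' y -> `|c (x, y)| <= M.

Let close_l v r x x' y : eball v r x -> eball v r x' ->
  `|c (x, y) - c (x', y)| <= 2 * (L * r).
Proof.
move=> xr x'r.
have -> : c (x, y) - c (x', y) = (c (x, y) - c (v, y)) + (c (v, y) - c (x', y)).
  by ring.
apply: le_trans (ler_normD _ _) _; rewrite mulr_natl mulr2n; apply: lerD.
  by apply: le_trans (cx _ _ _) _; rewrite ler_pM2l// ltW.
by apply: le_trans (cx _ _ _) _; rewrite enorm_distC ler_pM2l// ltW.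
Qed.

Let close_r v r x y y' : eball v r y -> eball v r y' ->
  `|c (x, y) - c (x, y')| <= 2 * (L * r).
Proof.
move=> xr x'r.
have -> : c (x, y) - c (x, y') = (c (x, y) - c (x, v)) + (c (x, v) - c (x, y')).
  by ring.
apply: le_trans (ler_normD _ _) _; rewrite mulr_natl mulr2n; apply: lerD.
  by apply: le_trans (cy _ _ _) _; rewrite ler_pM2l// ltW.
by apply: le_trans (cy _ _ _) _; rewrite enorm_distC ler_pM2l// ltW.
Qed.

Let two_three (delta : R) : 0 < delta -> 2 * (L * delta) < 3 * (L * delta).
Proof. by move=> d0; rewrite ltr_pM2r ?mulr_gt0// ltr_nat. Qed.

(** Over a ball of radius delta the cost varies by at most 2 L delta. The second moment bound wants
    a strict inequality and is applied with r = 3 L delta, hence 12 = 4 * 3. *)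
Lemma bias_bound (N : nat) (w : 'I_N -> E) (delta m eps : R) (n : nat)
    (dS : measure_display) (S : measurableType dS)
    (Pr : probability S R) (X Y : 'I_n.+1 -> {RV Pr >-> E}) :
  0 < delta -> 0 < eps -> eps <= 1 -> 1 <= m ->
  12 * (L * delta) <= eps * m `^ (p - 1) ->
  Om `<=` \bigcup_(i in [set: 'I_N]) eball (w i) delta \/
  Om' `<=` \bigcup_(i in [set: 'I_N]) eball (w i) delta ->
  two_sample P Q X Y ->
  (`| \int[Pr]_w OT (phi_p p) eps c (empirical (fun i => X i w))
                        (empirical (fun j => Y j w))
        - OT (phi_p p) eps c P Q |
   <= ((14 * M + 7) * (Num.sqrt (m + kappa p * N.+1%:R)
        / Num.sqrt n.+1%:R))%:E)%E.
Proof.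
move=> delta0 eps0 eps1 m1 dm wOm XY.
set Lb := m + kappa p * N.+1%:R.
have k0 := kappa_gt0 p.
have Lb0 : 0 < Lb by rewrite /Lb ltr_pwDl ?(lt_le_trans ltr01)// mulr_ge0// ltW.
set b := Num.sqrt Lb / Num.sqrt n.+1%:R.
have b0 : 0 < b by rewrite divr_gt0 ?sqrtr_gt0.
(* Replacing both arguments by representatives changes the cost by at most 4 L r = b/2, so the total
   discretization error 2 * (b/2) is b, of the order of the main term. *)
pose r := b / 2 / (4 * L).
have r0 : 0 < r by apply: divr_gt0; [exact: divr_gt0|exact: mulr_gt0].
have [I [k [grp [mk fine_k grp_k]]]] := partition_exists w delta bOm r0.
have [J [l [grp' [ml fine_l grp_l]]]] := partition_exists w delta bOm' r0.
have [rep [Omrep krep]] := representatives k (support_nonempty POm).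
have [rep' [Omrep' lrep']] := representatives l (support_nonempty QOm').
have [N1 [mN1 PN1 sN1]] := POm; have [N2 [mN2 QN2 sN2]] := QOm'.
have inOm x : ~ N1 x -> Om x by move=> nx; apply: contrapT => /sN1.
have inOm' y : ~ N2 y -> Om' y by move=> ny; apply: contrapT => /sN2.
pose C i j := c (rep i, rep' j).
have CM i j : `|C i j| <= M by exact: cM.
have cC x y : ~ N1 x -> ~ N2 y -> `|c (x, y) - C (k x) (l y)| <= b / 2.
  move=> /inOm Omx /inOm' Omy.
  have [v [vx vx']] := fine_k x (rep (k x)) Omx (esym (krep x Omx)).
  have [v' [vy vy']] := fine_l y (rep' (l y)) Omy (esym (lrep' y Omy)).
  have -> : c (x, y) - C (k x) (l y) = (c (x, y) - c (rep (k x), y))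
     + (c (rep (k x), y) - C (k x) (l y)) by ring.
  apply: le_trans (ler_normD _ _) _.
  have -> : b / 2 = 2 * (L * r) + 2 * (L * r).
    by rewrite /r; field; rewrite gt_eqF.
  by apply: lerD; [exact: (close_l _ vx vx')|exact: (close_r _ vy vy')].
have wa : weights (mass k P) := weights_mass P mk.
have wb : weights (mass l Q) := weights_mass Q ml.
have [f [g [fg fB gB]]] := optimal_exists p1 eps0 wa wb eps1 M0 CM.
have /choice[fgh fghP] : forall uv : {ffun 'I_n.+1 -> I} * {ffun 'I_n.+1 -> J},
    exists fg : (I -> R) * (J -> R),
    [/\ optimal p eps C (emp R uv.1) (emp R uv.2) fg.1 fg.2,
        forall i, 0 <= fg.1 i <= 4 * M + 2 & forall j, `|fg.2 j| <= 5 * M + 2].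
  move=> [u v]; have [f' [g' h]] := optimal_exists p1 eps0
    (weights_emp R u) (weights_emp R v) eps1 M0 CM.
  by exists (f', g').
have Lle : \sum_i mass k P i * \sum_j mass l Q j * density p eps C f g i j ^+ 2
    <= Lb.
  (* The groups are the N balls and [None]. *)
  have -> : Lb = m + kappa p * #|{: option 'I_N}|%:R by rewrite card_option card_ord.
  have dm4 : 4 * (3 * (L * delta)) <= eps * m `^ (p - 1).
    by apply: le_trans dm; rewrite mulrA -natrM.
  case: wOm => wOm.
    apply: (second_moment_le p1 eps0 wa wb fg (grp := grp) m1 _ dm4).
    move=> i i' ai ai' gi j.
    (* A cell of positive mass meets [Om], hence contains its representative. *)
    have [x [/inOm Omx kx]] := mass_gt0_meets mk mN1 PN1 ai.
    have [x' [/inOm Omx' kx']] := mass_gt0_meets mk mN1 PN1 ai'.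
    have ki : k (rep i) = i by rewrite -kx krep.
    have ki' : k (rep i') = i' by rewrite -kx' krep.
    have [||u [ui ui']] := grp_k (rep i) (rep i').
    - by have [u _ uu] := wOm _ (Omrep i); exists u.
    - by rewrite ki ki'.
    apply: le_lt_trans (ler_norm _) _; apply: le_lt_trans (two_three delta0).
    exact: (close_l _ ui' ui).
  apply: (second_moment_swap_le p1 eps0 wa wb fg (grp := grp') m1 _ dm4).
  move=> j j' bj bj' gj i.
  have [x [/inOm' Omx kx]] := mass_gt0_meets ml mN2 QN2 bj.
  have [x' [/inOm' Omx' kx']] := mass_gt0_meets ml mN2 QN2 bj'.
  have kj : l (rep' j) = j by rewrite -kx lrep'.
  have kj' : l (rep' j') = j' by rewrite -kx' lrep'.
  have [||u [uj uj']] := grp_l (rep' j) (rep' j').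
  - by have [u _ uu] := wOm _ (Omrep' j); exists u.
  - by rewrite kj kj'.
  apply: le_lt_trans (ler_norm _) _; apply: le_lt_trans (two_three delta0).
  exact: (close_r _ uj' uj).
(* The first potentials share the range [0, 4M+2]; the second are bounded by 5M+2 and differ by at
   most twice that. The sum is 14M+6, and the discretization adds 1. *)
have A0 : 0 < 4 * M + 2 by rewrite ltr_wpDl// mulr_ge0.
have B0 : 0 < 10 * M + 4 by rewrite ltr_wpDl// mulr_ge0.
apply: le_trans (sampling_bias XY mk ml p1 eps0 mN1 mN2 PN1 QN2 cC
  (fh := fun u v => (fgh (u, v)).1) (gh := fun u v => (fgh (u, v)).2)
  (A := 4 * M + 2) (B := 10 * M + 4) fg _ _ _ A0 B0 Lb0 Lle) _.
- by move=> u v; have [] := fghP (u, v).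
- move=> u v i; have [_ h _] := fghP (u, v).
  have /andP[h1 h2] := h i; have /andP[h3 h4] := fB i.
  by rewrite ler_norml; apply/andP; split; lra.
- move=> u v j; have [_ _ h] := fghP (u, v).
  apply: le_trans (ler_normB _ _) _.
  by have := h j; have := gB j; lra.
rewrite lee_fin -/b le_eqVlt; apply/orP; left; by apply/eqP; field.
Qed.

End bias_bound.

(** * Choice of the truncation level and the covering radius *)

Theorem theorem1p1 (R : realType) (d : nat)
    (P Q : probability 'rV[R]_d R) (Om Om' : set 'rV[R]_d)
    (c : 'rV[R]_d * 'rV[R]_d -> R) (p alpha : R)
    (bOm : bounded_set Om) (bOm' : bounded_set Om')
    (POm : P.-negligible (~` Om)) (QOm' : Q.-negligible (~` Om'))
    (lipc : lipschitz_cost c) (p1 : 1 <= p)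
    (halpha : (mine (minkowski_dim Om) (minkowski_dim Om') < alpha%:E)%E) :
  exists C eps0 : R, [/\ 0 < C, 0 < eps0 &
    forall (n : nat) (eps : R), 0 < eps <= eps0 ->
    forall (dS : measure_display) (S : measurableType dS)
      (Pr : probability S R) (X Y : 'I_n.+1 -> {RV Pr >-> 'rV[R]_d}),
    two_sample P Q X Y ->
    (`| \int[Pr]_w OT (phi_p p) eps c (empirical (fun i => X i w))
                        (empirical (fun j => Y j w))
        - OT (phi_p p) eps c P Q |
      <= (C * (eps `^ (- (alpha / (2 * (1 + (p - 1) * alpha))))
               / Num.sqrt n.+1%:R))%:E)%E].
Proof.
have [L [L0 cx cy]] := lipschitz_cost_bound lipc.
have [M [M0 cM]] := cost_bounded lipc bOm bOm'.
have [alpha0 [r0 [r00 cov]]] : 0 < alpha /\ exists r0, 0 < r0 /\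
    forall r, 0 < r < r0 -> exists N, [/\
      is_covering Om r N \/ is_covering Om' r N & N%:R <= r `^ (- alpha)].
  move: halpha; rewrite gt_min => /orP[dimOm|dimOm'].
    have [a0 [r0 [r00 cov]]] :=
      minkowski_covering (support_nonempty POm) dimOm.
    split=> //; exists r0; split=> // r /cov[N [cN Nr]].
    by exists N; split => //; left.
  have [a0 [r0 [r00 cov]]] :=
    minkowski_covering (support_nonempty QOm') dimOm'.
  split=> //; exists r0; split=> // r /cov[N [cN Nr]].
  by exists N; split => //; right.
set e := 1 + (p - 1) * alpha.
have e0 : 0 < e by rewrite /e ltr_wpDr// mulr_ge0 ?subr_ge0// ltW.
have k0 := kappa_gt0 p.
(* For delta and m as chosen below, delta^(-alpha) = [K1 * m]; since m >= 1, m + kappa (N + 1) is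
   then at most [K0 * m]. *)
pose K1 : R := (12 * L)^-1 `^ (- alpha).
pose K0 : R := 1 + kappa p * (K1 + 1).
have K10 : 0 <= K1 by exact: powR_ge0.
have K00 : 0 < K0.
  by rewrite ltr_pwDl ?ltr01// mulr_ge0 ?(ltW k0)// addr_ge0 ?ler01.
have L12 : 0 < 12 * L by rewrite mulr_gt0.
have L6 : 0 < 6 * L * r0 by rewrite !mulr_gt0.
(* The second bound on eps gives delta <= r0 / 2; eps <= 1 gives m >= 1 and is assumed in the bounds
   on the potentials. *)
exists ((14 * M + 7) * Num.sqrt K0), (Num.min 1 ((6 * L * r0) `^ e)); split.
- by rewrite mulr_gt0 ?sqrtr_gt0// ltr_wpDl// mulr_ge0.
- by rewrite lt_min ltr01 powR_gt0.
move=> n eps /andP[eps0]; rewrite le_min => /andP[eps1 epsr] dS S Pr X Y XY.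
(* [12 * L * delta] is both [eps * m `^ (p - 1)] and [m `^ (- alpha^-1)]. *)
pose m : R := eps `^ (- (alpha / e)).
have m1 : 1 <= m.
  rewrite /m -(powRr0 eps); apply: ger_powR; first by rewrite eps0.
  by rewrite oppr_le0 divr_ge0 ?(ltW e0) ?(ltW alpha0).
have m0 : 0 < m by apply: lt_le_trans m1.
pose delta : R := eps `^ e^-1 / (12 * L).
have delta0 : 0 < delta by rewrite divr_gt0// powR_gt0.
have deltar : delta < r0.
  rewrite /delta ltr_pdivrMr//; apply: (@le_lt_trans _ _ (6 * L * r0)).
    have -> : 6 * L * r0 = ((6 * L * r0) `^ e) `^ e^-1.
      by rewrite -powRrM mulfV ?gt_eqF// powRr1// ltW.
    by apply: ge0_ler_powR; rewrite ?nnegrE ?invr_ge0 ?powR_ge0 ?(ltW e0) ?(ltW eps0).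
  by rewrite [ltRHS]mulrC ltr_pM2r// ltr_pM2r// ltr_nat.
(* The exponents of eps agree, as 1 - (p-1) alpha / e = 1/e. *)
have deltam : 12 * (L * delta) <= eps * m `^ (p - 1).
  rewrite le_eqVlt; apply/orP; left; apply/eqP.
  rewrite mulrA mulrC mulfVK ?gt_eqF// /m -powRrM.
  rewrite -[X in X * _](powRr1 (ltW eps0)) -powRD; last first.
    by apply/implyP => _; rewrite gt_eqF.
  congr (_ `^ _); rewrite /e; field.
  by rewrite -/e gt_eqF.
have [N [covN Ndelta]] : exists N, [/\
      is_covering Om delta N \/ is_covering Om' delta N & N%:R <= delta `^ (- alpha)].
  by apply: cov; rewrite delta0.
have NK : N%:R <= K1 * m.
  apply: le_trans Ndelta _; rewrite /delta powRM ?powR_ge0 ?invr_ge0 ?(ltW L12)//.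
  have ea : e^-1 * - alpha = - (alpha / e) by rewrite mulrN mulrC.
  by rewrite -powRrM ea mulrC.
have [w wOm] : exists w : 'I_N -> 'rV[R]_d,
    Om `<=` \bigcup_(i in [set: 'I_N]) eball (w i) delta \/
    Om' `<=` \bigcup_(i in [set: 'I_N]) eball (w i) delta.
  by case: covN => -[w _ ww]; exists w; [left|right].
apply: le_trans (bias_bound bOm bOm' POm QOm' L0 M0 p1 cx cy cM delta0 eps0 eps1
  m1 deltam wOm XY) _.
rewrite lee_fin -mulrA ler_pM2l; last by rewrite ltr_wpDl// mulr_ge0.
rewrite mulrA ler_pM2r ?invr_gt0 ?sqrtr_gt0//.
have -> : eps `^ (- (alpha / (2 * e))) = Num.sqrt m.
  rewrite -powR12_sqrt ?(ltW m0)// /m -powRrM; congr (_ `^ _); field.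
  by rewrite gt_eqF.
rewrite -sqrtrM ?(ltW K00)//; apply: ler_wsqrtr.
rewrite /K0 mulrDl mul1r lerD2l -mulrA ler_pM2l// mulrDl mul1r -natr1.
exact: lerD.
Qed.
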